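(* Let $d\ge2$ and fix $L\in(0,\infty)$. As $\lambda\to\infty$, the re-scaled boundary $T^{(\lambda)}(\partial K_\lambda)$ converges in probability to $\partial(\Phi(\mathcal P))$ in the space $\mathcal C(B_{d-1}(\mathbf 0,L))$ of continuous functions on $B_{d-1}(\mathbf 0,L)$ equipped with the supremum norm.
   Context: Gaussian polytope: $\phi(x)=(2\pi)^{-d/2}\exp(-|x|^2/2)$ on $\mathbb R^d$; $\mathcal P_\lambda$ is a Poisson point process on $\mathbb R^d$ with intensity $\lambda\phi(x)\,dx$; $K_\lambda$ is the convex hull of $\mathcal P_\lambda$. $B_{d-1}(\mathbf 0,L)$ is the closed Euclidean ball in $\mathbb R^{d-1}$ of radius $L$ centered at the origin. Scaling transform: $R_\lambda:=\sqrt{2\log\lambda-\log(2(2\pi)^d\log\lambda)}$, and $\lambda\ge\lambda_0$ where $\lambda_0$ is such that $R_\lambda\in[1,\infty)$ for $\lambda\ge\lambda_0$. Let $u_0=(0,\dots,0,1)\in\mathbb R^d$, with the tangent space of $\mathbb S^{d-1}$ at $u_0$ identified with $\mathbb R^{d-1}$. The exponential map is $\exp_{d-1}(v)=\cos(|v|)u_0+\sin(|v|)(v/|v|,0)$ for $v\in\mathbb R^{d-1}\setminus\{\mathbf 0\}$, $\exp_{d-1}(\mathbf 0)=u_0$; $\exp_{d-1}^{-1}$ takes values in the ball of radius $\pi$ centered at the origin, with $\exp_{d-1}^{-1}(-u_0)=(0,\dots,0,\pi)$. For $x\ne\mathbf 0$, $T^{(\lambda)}(x):=\big(R_\lambda\exp_{d-1}^{-1}(x/|x|),\,R_\lambda^2(1-|x|/R_\lambda)\big)$,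 and $T^{(\lambda)}(\mathbf 0):=(\mathbf 0,R_\lambda^2)$. Limit: $\mathcal P$ is a Poisson point process on $\mathbb R^{d-1}\times\mathbb R$ (points $w=(v,h)$) with intensity $e^h\,dh\,dv$. $\Pi^{\downarrow}:=\{(v,h):h\le-|v|^2/2\}$, $\Pi^{\downarrow}(w):=w\oplus\Pi^{\downarrow}$, and $\Phi(\mathcal P)$ is the union of all $\Pi^{\downarrow}(w)$, $w\in\mathbb R^{d-1}\times\mathbb R$, with $\mathcal P\cap{\rm int}(\Pi^{\downarrow}(w))=\emptyset$. Conventions: $\partial(\Phi(\mathcal P))$ is regarded as the function $v\mapsto h$ whose graph it is; likewise $T^{(\lambda)}(\partial K_\lambda)$ is regarded as a function of $v\in B_{d-1}(\mathbf 0,L)$ through its graph (this makes sense on the event that the origin is interior to $K_\lambda$, whose probability tends to $1$, and for $\lambda$ large). Convergence in probability is understood with $\mathcal P^{(\lambda)}:=T^{(\lambda)}(\mathcal P_\lambda)$ and $\mathcal P$ coupled on a common probability space so that, for every compact $D\subset\mathbb R^{d-1}\times\mathbb R$, the probability that $\mathcal P^{(\lambda)}\cap D=\mathcal P\cap D$ tends to $1$ as $\lambda\to\infty$. *)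

(* Defs.v *)
From HB Require Import structures.
From mathcomp Require Import all_boot all_order all_algebra.
From mathcomp Require Import all_classical all_reals all_analysis.
From mathcomp Require Import measurable_realfun.

Set Implicit Arguments.
Unset Strict Implicit.
Unset Printing Implicit Defensive.

Import Order.TTheory GRing.Theory Num.Theory.
Import numFieldNormedType.Exports.

Local Open Scope classical_set_scope.
Local Open Scope ring_scope.

(* R^n is 'rV[R]_n. The sup norm that the library puts on it is only used    *)
(* for its topology; the norm of the paper is enorm below.                    *)

Section row_vectors.
Variable R : realType.

Definition enorm n (v : 'rV[R]_n) : R := Num.sqrt (\sum_i v ord0 i ^+ 2).

(* (v, x), under the identification of R^n x R with R^(n+1) *)
Definition rv_rcons n (v : 'rV[R]_n) (x : R) : 'rV[R]_n.+1 :=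
  \row_i oapp (fun j => v ord0 j) x (unlift ord_max i).

Definition eball n (L : R) : set 'rV[R]_n := [set v | enorm v <= L].

End row_vectors.

Section row_vector_measurable.
Variables (R : realType) (n : nat).

Let coord (i : 'I_n) (v : 'rV[R]_n) : R := v ord0 i.

Let rv_set0 : g_sigma_preimage coord set0.
Proof. exact: sigma_algebra0. Qed.

Let rv_setC A : g_sigma_preimage coord A -> g_sigma_preimage coord (~` A).
Proof. exact: sigma_algebraC. Qed.

Let rv_bigcup (F : (set 'rV[R]_n)^nat) :
  (forall i, g_sigma_preimage coord (F i)) ->
  g_sigma_preimage coord (\bigcup_i (F i)).
Proof. exact: sigma_algebra_bigcup. Qed.

(* The sigma-algebra generated by the coordinates, i.e., the Borel one. *)
HB.instance Definition _ :=
  @isMeasurable.Build (measure_tuple_display default_measure_display)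
    'rV[R]_n (g_sigma_preimage coord) rv_set0 rv_setC rv_bigcup.

Lemma measurable_rv_coord (i : 'I_n) :
  measurable_fun [set: 'rV[R]_n] (fun v => v ord0 i).
Proof.
move=> _ Y mY; rewrite setTI; apply: sub_sigma_algebra => /=.
rewrite -bigcup_seq/=; exists i => /=; first by rewrite mem_index_enum.
by exists Y => //; rewrite setTI.
Qed.

Lemma measurable_fun_rv d (T : measurableType d) (f : T -> 'rV[R]_n) :
  (forall i, measurable_fun [set: T] (fun t => f t ord0 i)) ->
  measurable_fun [set: T] f.
Proof.
move=> mf _ A mA; rewrite setTI.
have : g_sigma_preimage (fun i => coord i \o f) (f @^-1` A).
  by rewrite g_sigma_preimage_comp; exists A => //; rewrite setTI.
apply: smallest_sub; first exact: sigma_algebra_measurable.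
rewrite -bigcup_seq => B [i _ [C mC <-]].
exact: mf.
Qed.

End row_vector_measurable.

Section lebesgue.
Variable R : realType.

Lemma measurable_rv_rcons n :
  measurable_fun setT (fun p : 'rV[R]_n * R => rv_rcons p.1 p.2).
Proof.
apply: measurable_fun_rv => i; rewrite /rv_rcons.
case: (unliftP ord_max i) => [j|] ->.
- apply: (eq_measurable_fun (fun p : 'rV[R]_n * R => p.1 ord0 j)).
    by move=> p _; rewrite mxE liftK.
  by apply: (measurableT_comp (measurable_rv_coord _)).
- apply: (eq_measurable_fun snd) => // p _.
  by rewrite mxE unlift_none.
Qed.

Section step.
Variables (n : nat) (m : {sigma_finite_measure set 'rV[R]_n -> \bar R}).

Definition rv_prod : set 'rV[R]_n.+1 -> \bar R :=
  pushforward (m \x @lebesgue_measure R)%E (fun p => rv_rcons p.1 p.2).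

Let rv_prod0 : rv_prod set0 = 0%E.
Proof. by rewrite /rv_prod /pushforward preimage_set0 measure0. Qed.

Let rv_prod_ge0 A : (0 <= rv_prod A)%E.
Proof. by rewrite /rv_prod /pushforward measure_ge0. Qed.

Let rv_prod_sigma_additive : semi_sigma_additive rv_prod.
Proof.
have mE A : measurable A ->
    measurable ((fun p : 'rV[R]_n * R => rv_rcons p.1 p.2) @^-1` A).
  by move=> mA; rewrite -[X in measurable X]setTI; exact: measurable_rv_rcons.
move=> F mF tF mUF; rewrite /rv_prod /pushforward preimage_bigcup.
apply: measure_semi_sigma_additive.
- by move=> k; exact: mE.
- apply/trivIsetP => /= i j _ _ ij; rewrite -preimage_setI.
  by move/trivIsetP : tF => /(_ _ _ _ _ ij) ->//; rewrite preimage_set0.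
- by rewrite -preimage_bigcup; exact: mE.
Qed.

HB.instance Definition _ := isMeasure.Build _ _ _ rv_prod
  rv_prod0 rv_prod_ge0 rv_prod_sigma_additive.

Let rv_prod_sigma_finite : sigma_finite setT rv_prod.
Proof.
have /sigma_finiteP[F [TF ndF Foo]] := sigma_finiteT m.
have /sigma_finiteP[G [TG ndG Goo]] := sigma_finiteT (@lebesgue_measure R).
pose h (v : 'rV[R]_n.+1) : 'rV[R]_n * R :=
  (\row_j v ord0 (lift ord_max j), v ord0 ord_max).
have hK p : h (rv_rcons p.1 p.2) = p.
  case: p => v x; rewrite /h /rv_rcons; congr (_, _) => /=.
    by apply/rowP => j; rewrite !mxE liftK.
  by rewrite mxE unlift_none.
have mh A B : measurable A -> measurable B -> measurable (h @^-1` (A `*` B)).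
  move=> mA mB; rewrite -[X in measurable X]setTI.
  have mh : measurable_fun setT h.
    apply/measurable_fun_pairP; split; last exact: measurable_rv_coord.
    apply: measurable_fun_rv => j.
    apply: (eq_measurable_fun (fun v : 'rV[R]_n.+1 => v ord0 (lift ord_max j))).
      by move=> v _; rewrite /= mxE.
    exact: measurable_rv_coord.
  by apply: mh => //; exact: measurableX.
exists (fun k => h @^-1` (F k `*` G k)).
  apply/seteqP; split => // v _.
  have : [set: 'rV[R]_n] (h v).1 by [].
  have : [set: R] (h v).2 by [].
  rewrite TF TG => -[k _ Gk] [j _ Fj]; exists (maxn k j) => //; split.
  - by move: Fj; exact/subsetPset/ndF/leq_maxr.
  - by move: Gk; exact/subsetPset/ndG/leq_maxl.
move=> k; have [mF Fk] := Foo k; have [mG Gk] := Goo k.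
split; first exact: mh.
rewrite /rv_prod /pushforward.
rewrite (_ : _ @^-1` _ = F k `*` G k).
  by rewrite product_measure1E// lte_mul_pinfty// ge0_fin_numE.
apply/seteqP; split => p.
  by rewrite -[p in X in _ -> X]hK.
by rewrite -[p in X in X -> _]hK.
Qed.

HB.instance Definition _ := Measure_isSigmaFinite.Build _ _ _ rv_prod
  rv_prod_sigma_finite.

End step.

(* Lebesgue measure on R^n: the point mass for n = 0, and the product of      *)
(* Lebesgue measures on R^n and R for n.+1.                                   *)
Fixpoint rv_lebesgue n : {sigma_finite_measure set 'rV[R]_n -> \bar R} :=
  match n with
  | 0 => dirac (0 : 'rV[R]_0)
  | k.+1 => rv_prod (rv_lebesgue k)
  end.

End lebesgue.

Section geometry.
Variable R : realType.

Definition boundary (T : topologicalType) (A : set T) : set T :=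
  closure A `\` A°.

Definition convex_hull n (A : set 'rV[R]_n) : set 'rV[R]_n :=
  smallest (@convex_set R 'rV[R]_n) A.

Definition downward_paraboloid n : set ('rV[R]_n * R) :=
  [set w | w.2 <= - enorm w.1 ^+ 2 / 2].

Definition downward_paraboloid_at n (w : 'rV[R]_n * R) : set ('rV[R]_n * R) :=
  [set w + z | z in downward_paraboloid (n := n)].

Definition paraboloid_hull n (X : set ('rV[R]_n * R)) : set ('rV[R]_n * R) :=
  \bigcup_(w in [set w | X `&` (downward_paraboloid_at w)° = set0])
    downward_paraboloid_at w.

(* S is, over D, the graph of the function f, which is continuous on D. *)
Definition continuous_graph_on (V : topologicalType) (D : set V)
    (S : set (V * R)) (f : V -> R) : Prop :=
  {within D, continuous f} /\ S `&` (D `*` setT) = [set (v, f v) | v in D].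

Definition sup_dist (V : Type) (D : set V) (f g : V -> R) : \bar R :=
  ereal_sup [set `|f v - g v|%:E | v in D].

End geometry.

(* In this section d = n.+1, so that R^(d-1) is 'rV[R]_n. *)
Section scaling.
Variables (R : realType) (n : nat).
Implicit Types (lambda : R) (x : 'rV[R]_n.+1) (v : 'rV[R]_n).

Definition gaussian_density x : R :=
  (2 * pi) `^ (- n.+1%:R / 2) * expR (- enorm x ^+ 2 / 2).

Definition scaling_radius lambda : R :=
  Num.sqrt (2 * ln lambda - ln (2 * (2 * pi) ^+ n.+1 * ln lambda)).

Definition north : 'rV[R]_n.+1 := rv_rcons 0 1.

(* At v = 0 the second term vanishes, as 0 / 0 = 0. *)
Definition exp_map v : 'rV[R]_n.+1 :=
  cos (enorm v) *: north + sin (enorm v) *: rv_rcons ((enorm v)^-1 *: v) 0.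

(* Away from - north, a unit vector has a unique antecedent of norm < pi; at  *)
(* - north, the value is (0, ..., 0, pi).                                     *)
Definition exp_map_inv x : 'rV[R]_n :=
  if x == - north then \row_i (if i.+1 == n then pi else 0)
  else get [set v | enorm v < pi /\ exp_map v = x].

Definition scaling lambda x : 'rV[R]_n * R :=
  let r := scaling_radius lambda in
  if x == 0 then (0, r ^+ 2)
  else (r *: exp_map_inv ((enorm x)^-1 *: x), r ^+ 2 * (1 - enorm x / r)).

Definition gaussian_intensity lambda (B : set 'rV[R]_n.+1) : \bar R :=
  \int[@rv_lebesgue R n.+1]_(x in B) (lambda * gaussian_density x)%:E.

Definition limit_intensity (B : set ('rV[R]_n * R)) : \bar R :=
  \int[(@rv_lebesgue R n \x @lebesgue_measure R)%E]_(w in B) (expR w.2)%:E.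

End scaling.

Section point_processes.
Context {d d' : measure_display} {Omega : measurableType d}
  {T : measurableType d'} {R : realType}.
Variables (P : probability Omega R) (X : Omega -> set T).

Definition point_count (B : set T) (omega : Omega) : \bar R :=
  counting (X omega `&` B).

(* The counts of disjoint sets take values in the countable set               *)
(* {0, 1, ..., +oo}, so their independence is the product rule for point      *)
(* values. The dummy argument 0%N of poisson_prob is unused by the library.   *)
Definition poisson_point_process (Lambda : set T -> \bar R) : Prop :=
  [/\ forall B, measurable B -> measurable_fun setT (point_count B),
      forall B, measurable B -> (Lambda B < +oo)%E -> forall k : nat,
        P [set omega | point_count B omega = k%:R%:E] =
          poisson_prob (fine (Lambda B)) 0%N [set k],
      forall B, measurable B -> Lambda B = +oo%E ->
        P [set omega | point_count B omega = +oo%E] = 1%E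
    & forall m (B : 'I_m -> set T), (forall i, measurable (B i)) ->
        trivIset setT B -> forall k : 'I_m -> \bar R,
        P [set omega | forall i, point_count (B i) omega = k i] =
          (\prod_(i < m) P [set omega | point_count (B i) omega = k i])%E].

End point_processes.

(* The probability of E tends to 1 as lambda -> +oo. Through the outer measure *)
(* of P, which is P itself on events, this requires no measurability of E.     *)
Definition with_high_probability (d : measure_display)
    (Omega : measurableType d) (R : realType) (P : probability Omega R)
    (E : R -> set Omega) : Prop :=
  mu_ext P (~` E lambda) @[lambda --> +oo%R] --> 0%E.

(* Main.v *)
Require Import Defs.
From HB Require Import structures.
From mathcomp Require Import all_boot all_order all_algebra.
From mathcomp Require Import all_classical all_reals all_analysis.
From mathcomp Require Import measurable_realfun ring lra.
From mathcomp Require finmap.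

Import Order.TTheory GRing.Theory Num.Theory.
Import numFieldNormedType.Exports.

Local Open Scope classical_set_scope.
Local Open Scope ring_scope.

Set Implicit Arguments.
Unset Strict Implicit.
Unset Printing Implicit Defensive.

(** Both boundaries are lower convex envelopes of point sets, and convex
    envelopes are stable under local convergence of the points.

    On the limit side, the map (v, h) |-> (v, h + |v|^2 / 2) ([unbend]) turns
    the translates of the downward paraboloid into half-spaces, so that the
    hull of the empty paraboloids is the region below the supremum of the affine
    functions that pass below all the unbent points of the limit process
    ([paraboloid_hullP], [boundary_paraboloid_hull]).  On the Gaussian side, the
    affine map x |-> (x', r^2 - r x_d) ([flat]) preserves convex hulls, and the
    half-spaces that contain the whole process and have the origin in their
    interior are, when they face the north pole, again the affine functions
    below all the flattened points ([polar_minorant]).  By duality, the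
    boundary of a convex hull with the origin in its interior is the unit level
    set of the support function of its polar ([boundary_hull]); along the
    directions of the window, the intersection of a ray with a hyperplane is at
    the height given by the affine function minus |v|^2 / 2, up to an error of
    order r^-2 ([ray_height_close]), because the rays from the far-away origin
    are almost vertical.

    The flattened coordinates of a point tend to the unbent ones of its scaled
    image, uniformly on compact sets ([flat_close]).  What has to be excluded is
    an influence of remote points.  If every orthant contains a point of the
    process that is not too high, then an affine minorant that matters over the
    window has a bounded slope ([minorant_slope]); and if all the points lie
    above the parabola - A + |v|^2 / 4, then a point outside a large compact
    window is above every affine function of bounded slope.  Hence the two
    sets of relevant minorants are close to each other as soon as the two
    processes coincide on the window ([hull_boundary_close], which is purely
    deterministic).

    The probabilistic input consists of void probabilities.  The expected number
    of points below the parabola is at most a constant times e^-A, for the limit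
    process and for the Gaussian ones alike: the inequality
    t^2 / 2 >= r t - r^2 / 2 bounds the Gaussian weight of the height by the
    exponential one, with a prefactor that the choice of the scaling radius
    keeps bounded ([limit_intensity_low], [gaussian_intensity_low],
    [near_scaling_radius]).  The points needed in each orthant exist with large
    probability because boxes of growing height, or of fixed size under a growing
    intensity, have a large expected number of points. *)

(** * Row vectors *)
Definition dot (R : realType) n (a x : 'rV[R]_n) : R :=
  \sum_i a ord0 i * x ord0 i.

(** Slopes are measured in this norm because it is what a set with a point in
    each orthant controls, see [norm1_le_dot]. *)
Definition norm1 (R : realType) n (a : 'rV[R]_n) : R := \sum_i `|a ord0 i|.

Definition rv_head (R : realType) n (x : 'rV[R]_n.+1) : 'rV[R]_n :=
  \row_j x ord0 (lift ord_max j).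

Definition rv_last (R : realType) n (x : 'rV[R]_n.+1) : R := x ord0 ord_max.

Section vectors.
Context {R : realType}.
Implicit Types n : nat.

Lemma rv_rcons_lift n (v : 'rV[R]_n) t j : rv_rcons v t ord0 (lift ord_max j) = v ord0 j.
Proof. by rewrite mxE liftK. Qed.

Lemma rv_last_rcons n (v : 'rV[R]_n) t : rv_last (rv_rcons v t) = t.
Proof. by rewrite /rv_last mxE unlift_none. Qed.

Lemma rv_head_rcons n (v : 'rV[R]_n) t : rv_head (rv_rcons v t) = v.
Proof. by apply/rowP => j; rewrite mxE rv_rcons_lift. Qed.

Lemma rv_rconsK n (x : 'rV[R]_n.+1) : rv_rcons (rv_head x) (rv_last x) = x.
Proof.
apply/rowP => i; case: (unliftP ord_max i) => [j|] ->.
  by rewrite rv_rcons_lift mxE.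
exact: rv_last_rcons.
Qed.

Lemma rv_eq n (x y : 'rV[R]_n.+1) :
  rv_head x = rv_head y -> rv_last x = rv_last y -> x = y.
Proof. by move=> h l; rewrite -(rv_rconsK x) -(rv_rconsK y) h l. Qed.

Lemma rv_headZ n k (x : 'rV[R]_n.+1) : rv_head (k *: x) = k *: rv_head x.
Proof. by apply/rowP => j; rewrite !mxE. Qed.

Lemma rv_lastZ n k (x : 'rV[R]_n.+1) : rv_last (k *: x) = k * rv_last x.
Proof. by rewrite /rv_last mxE. Qed.

Lemma sum_lift_max (V : nmodType) n (F : 'I_n.+1 -> V) :
  \sum_i F i = \sum_(j < n) F (lift ord_max j) + F ord_max.
Proof.
rewrite big_ord_recr/=; congr (_ + _); apply: eq_bigr => j _; congr F.
by apply: val_inj; rewrite /= /bump leqNgt ltn_ord.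
Qed.

Lemma dot_split n (a x : 'rV[R]_n.+1) :
  dot a x = dot (rv_head a) (rv_head x) + rv_last a * rv_last x.
Proof.
rewrite /dot sum_lift_max; congr (_ + _).
by apply: eq_bigr => j _; rewrite !mxE.
Qed.

Lemma dotC n (a x : 'rV[R]_n) : dot a x = dot x a.
Proof. by apply: eq_bigr => i _; rewrite mulrC. Qed.

Lemma dotDr n (a x y : 'rV[R]_n) : dot a (x + y) = dot a x + dot a y.
Proof. by rewrite -big_split; apply: eq_bigr => i _; rewrite mxE mulrDr. Qed.

Lemma dotZr n k (a x : 'rV[R]_n) : dot a (k *: x) = k * dot a x.
Proof. by rewrite mulr_sumr; apply: eq_bigr => i _; rewrite mxE mulrCA. Qed.

Lemma dotNr n (a x : 'rV[R]_n) : dot a (- x) = - dot a x.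
Proof. by rewrite -scaleN1r dotZr mulN1r. Qed.

Lemma dotBr n (a x y : 'rV[R]_n) : dot a (x - y) = dot a x - dot a y.
Proof. by rewrite dotDr dotNr. Qed.

Lemma dotZl n k (a x : 'rV[R]_n) : dot (k *: a) x = k * dot a x.
Proof. by rewrite dotC dotZr dotC. Qed.

Lemma dotBl n (a b x : 'rV[R]_n) : dot (a - b) x = dot a x - dot b x.
Proof. by rewrite dotC dotBr !(dotC x). Qed.

Lemma dot0l n (x : 'rV[R]_n) : dot 0 x = 0.
Proof. by rewrite /dot big1// => i _; rewrite mxE mul0r. Qed.

Lemma enorm_ge0 n (v : 'rV[R]_n) : 0 <= enorm v.
Proof. exact: sqrtr_ge0. Qed.

Lemma sqr_enorm n (v : 'rV[R]_n) : enorm v ^+ 2 = dot v v.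
Proof. by rewrite sqr_sqrtr// sumr_ge0// => i _; rewrite sqr_ge0. Qed.

Lemma sqr_enorm_split n (x : 'rV[R]_n.+1) :
  enorm x ^+ 2 = enorm (rv_head x) ^+ 2 + rv_last x ^+ 2.
Proof. by rewrite !sqr_enorm dot_split. Qed.

Lemma enorm_eq n (v : 'rV[R]_n) (r : R) : 0 <= r -> dot v v = r ^+ 2 -> enorm v = r.
Proof. by move=> r0; rewrite -sqr_enorm => /eqP; rewrite eqrXn2// ?enorm_ge0// => /eqP. Qed.

Lemma enormZ n k (v : 'rV[R]_n) : enorm (k *: v) = `|k| * enorm v.
Proof.
apply: enorm_eq; first by rewrite mulr_ge0// enorm_ge0.
by rewrite dotZl dotZr exprMn real_normK ?num_real// sqr_enorm expr2 mulrA.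
Qed.

Lemma enorm0 n : enorm (0 : 'rV[R]_n) = 0.
Proof. by apply: enorm_eq => //; rewrite dot0l expr0n. Qed.

Lemma abs_coord_le n (v : 'rV[R]_n) i : `|v ord0 i| <= enorm v.
Proof.
rewrite -(ler_pXn2r (ltn0Sn 1)) ?nnegrE ?enorm_ge0// sqr_enorm /dot (bigD1 i)//=.
rewrite real_normK ?num_real// expr2 lerDl sumr_ge0// => j _.
by rewrite -expr2 sqr_ge0.
Qed.

Lemma enorm_eq0 n (v : 'rV[R]_n) : (enorm v == 0) = (v == 0).
Proof.
apply/eqP/eqP => [v0|->]; last exact: enorm0.
apply/rowP => i; rewrite mxE; apply/eqP; rewrite -normr_le0 -v0.
exact: abs_coord_le.
Qed.

Lemma norm1_ge0 n (a : 'rV[R]_n) : 0 <= norm1 a.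
Proof. exact: sumr_ge0. Qed.

Lemma norm1_split n (a : 'rV[R]_n.+1) :
  norm1 a = norm1 (rv_head a) + `|rv_last a|.
Proof.
rewrite /norm1 sum_lift_max; congr (_ + _).
by apply: eq_bigr => j _; rewrite mxE.
Qed.

Lemma ler_abs_dot n (a x : 'rV[R]_n) M :
  (forall i, `|x ord0 i| <= M) -> `|dot a x| <= norm1 a * M.
Proof.
move=> xM; rewrite mulr_suml (le_trans (ler_norm_sum _ _ _))//.
by apply: ler_sum => i _; rewrite normrM ler_wpM2l.
Qed.

Lemma ler_dot n (a x : 'rV[R]_n) M :
  (forall i, `|x ord0 i| <= M) -> dot a x <= norm1 a * M.
Proof. by move=> /(ler_abs_dot a); apply: le_trans; exact: ler_norm. Qed.

Lemma ler_dot_enorm n (a x : 'rV[R]_n) : `|dot a x| <= norm1 a * enorm x.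
Proof. by apply: ler_abs_dot => i; exact: abs_coord_le. Qed.

(** In the orthant given by the signs of [a], each term of the pairing is the
    product of the moduli of the coordinates. *)
Lemma norm1_le_dot n (a x : 'rV[R]_n) c :
  (forall i, c <= (-1) ^+ (a ord0 i < 0)%R * x ord0 i) -> c * norm1 a <= dot a x.
Proof.
move=> cx; rewrite mulr_sumr; apply: ler_sum => i _.
have := cx i; case: ltrP => [a0|a0] /=; rewrite ?(expr0, expr1, mul1r, mulN1r) => h.
- by rewrite ltr0_norm//; nra.
- by rewrite ger0_norm//; nra.
Qed.

Lemma continuous_sum (T : topologicalType) n (F : 'I_n -> T -> R) :
  (forall i, continuous (F i)) -> continuous (fun x => \sum_i F i x).
Proof.
move=> cF x; apply: (@cvg_big _ _ +%R 0 xpredT _ _ _ (index_enum _)) => [|i _].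
  exact: add_continuous.
exact: cF.
Qed.

Lemma continuous_dot n (a : 'rV[R]_n) : continuous (dot a : 'rV[R]_n -> R).
Proof.
apply: (@continuous_sum _ _ (fun i (x : 'rV[R]_n) => a ord0 i * x ord0 i)) => i x.
by apply: (@cvgMl_tmp _ _ (nbhs (x : 'rV[R]_n))); exact: (@coord_continuous R 1 n ord0 i x).
Qed.

Lemma continuous_sqr_enorm n : continuous (fun v : 'rV[R]_n => enorm v ^+ 2).
Proof.
rewrite (_ : (fun v => _) = fun v : 'rV[R]_n => \sum_i v ord0 i * v ord0 i); last first.
  by apply/funext => v; rewrite sqr_enorm.
apply: (@continuous_sum _ _ (fun i (v : 'rV[R]_n) => v ord0 i * v ord0 i)) => i x.
by apply: (@cvgM _ _ (nbhs (x : 'rV[R]_n))); exact: (@coord_continuous R 1 n ord0 i x).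
Qed.

Lemma continuous_enorm n : continuous (@enorm R n).
Proof.
rewrite (_ : @enorm R n = fun v => Num.sqrt (enorm v ^+ 2)); last first.
  by apply/funext => v; rewrite sqrtr_sqr ger0_norm ?enorm_ge0.
move=> x; apply: (continuous_comp (@continuous_sqr_enorm n x)).
exact: sqrt_continuous.
Qed.

End vectors.

(** * Convex hulls and their polar *)

Definition polar (R : realType) n (X : set 'rV[R]_n) : set 'rV[R]_n :=
  [set a | forall x, X x -> dot a x <= 1].

(** As the support function of the polar, this is the Minkowski functional of
    the closed convex hull when the origin is in the interior of the latter. *)
Definition gauge (R : realType) n (X : set 'rV[R]_n) (u : 'rV[R]_n) : R :=
  sup [set dot a u | a in polar X].

(** Having a point in each orthant, away from the coordinate hyperplanes, is a
    quantitative way for the hull to surround the origin that only involves the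
    non-emptiness of finitely many boxes. *)
Definition sign_covered (R : realType) n (c : R) (X : set 'rV[R]_n) : Prop :=
  forall tau : 'I_n -> bool,
    exists2 x, X x & forall i, c <= (-1) ^+ tau i * x ord0 i.

Section convex_hulls.
Context {R : realType}.
Implicit Types n : nat.

Lemma convex_comb n (A : set 'rV[R]_n) x y (t : R) :
  @convex_set R 'rV[R]_n A -> A x -> A y -> 0 <= t <= 1 ->
  A (t *: x + (1 - t) *: y).
Proof.
move=> cA Ax Ay t01.
have := cA x y (Itv01 (andP t01).1 (andP t01).2).
by rewrite !inE => /(_ Ax Ay).
Qed.

Lemma convex_setP n (A : set 'rV[R]_n) :
  (forall x y (t : R), A x -> A y -> 0 <= t <= 1 -> A (t *: x + (1 - t) *: y)) ->
  @convex_set R 'rV[R]_n A.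
Proof.
move=> cA x y l; rewrite !inE => Ax Ay.
by apply: cA => //; apply/andP; split; [exact: ge0|exact: le1].
Qed.

Lemma convex_hull_convex n (X : set 'rV[R]_n) :
  @convex_set R 'rV[R]_n (convex_hull X).
Proof.
apply: convex_setP => x y t hx hy t01 B [cB XB].
by apply: convex_comb => //; [exact: hx|exact: hy].
Qed.

Lemma convex_hull_dot_le n (X : set 'rV[R]_n) a m :
  (forall x, X x -> dot a x <= m) -> forall x, convex_hull X x -> dot a x <= m.
Proof.
move=> Xm; apply: smallest_sub => //.
apply: convex_setP => x y t /= hx hy /andP[t0 t1].
by rewrite dotDr !dotZr; nra.
Qed.

(** Every coordinate can be adjusted in turn by mixing two points whose signs
    differ in that coordinate only. *)
Lemma cube_sub_convex_hull n (X : set 'rV[R]_n) c : 0 < c ->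
  sign_covered c X ->
  forall z : 'rV[R]_n, (forall i, `|z ord0 i| <= c) -> convex_hull X z.
Proof.
move=> c0 cov z zc.
suff H k : (k <= n)%N -> forall tau : 'I_n -> bool, exists2 y, convex_hull X y &
    forall i : 'I_n, if (i < k)%N then y ord0 i = z ord0 i
                     else c <= (-1) ^+ tau i * y ord0 i.
  have [y hy yz] := H n (leqnn n) (fun=> false).
  suff -> : z = y by [].
  by apply/rowP => i; have := yz i; rewrite ltn_ord => ->.
elim: k => [_ tau|k IH kn tau].
  have [x Xx xc] := cov tau; exists x => //.
  exact: sub_gen_smallest.
have ki (i : 'I_n) : (i < k.+1)%N = (i == Ordinal kn) || (i < k)%N.
  by rewrite ltnS leq_eqVlt.
have [p hp pz] := IH (ltnW kn) (fun i => (i != Ordinal kn) && tau i).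
have [m hm mz] := IH (ltnW kn) (fun i => (i == Ordinal kn) || tau i).
have := pz (Ordinal kn); have := mz (Ordinal kn).
rewrite ltnn eqxx/= expr1 expr0 mulN1r mul1r => mk pk.
have := zc (Ordinal kn); rewrite ler_norml => /andP[z1 z2].
set zk := z ord0 _ in z1 z2; set pk' := p ord0 _ in pk; set mk' := m ord0 _ in mk.
have d0 : 0 < pk' - mk' by lra.
pose t := (zk - mk') / (pk' - mk').
have tE : t * (pk' - mk') = zk - mk' by rewrite divfK// gt_eqF.
have t01 : 0 <= t <= 1.
  by rewrite /t divr_ge0/= ?ler_pdivrMr ?mul1r//; lra.
exists (t *: p + (1 - t) *: m); first exact: convex_comb (@convex_hull_convex _ _) _ _ _.
move=> i; rewrite ki; case: eqVneq => [->|ik] /=.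
  by rewrite !mxE -/pk' -/mk' -/zk; lra.
have := pz i; have := mz i; rewrite (negbTE ik)/=; case: ifP => _.
  by rewrite !mxE => -> ->; ring.
rewrite !mxE => a b; have /andP[t0 t1] := t01.
set s := (-1) ^+ _ in a b *; nra.
Qed.

Lemma sign_covered_dot n (X : set 'rV[R]_n) c a : sign_covered c X ->
  exists2 x, X x & c * norm1 a <= dot a x.
Proof.
move=> /(_ (fun i => a ord0 i < 0)%R)[x Xx xc]; exists x => //.
exact: norm1_le_dot.
Qed.

Section polar.
Variables (n : nat) (X : set 'rV[R]_n) (c : R).
Hypotheses (c0 : 0 < c) (cov : sign_covered c X).

(** The point of the orthant of [a] is in the half-space of [a]. *)
Lemma polar_norm1 a : polar X a -> norm1 a <= c^-1.
Proof.
move=> Xa; have [x Xx ax] := sign_covered_dot a cov.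
by rewrite -[c^-1]mul1r ler_pdivlMr// mulrC (le_trans ax)//; exact: Xa.
Qed.

Lemma polar0 : polar X 0.
Proof. by move=> x _; rewrite dot0l. Qed.

Lemma gauge_ge u a : polar X a -> dot a u <= gauge X u.
Proof.
move=> Xa; apply: ub_le_sup; last by exists a.
exists (c^-1 * enorm u) => _ [b Xb <-].
rewrite (le_trans (ler_norm _))// (le_trans (ler_dot_enorm _ _))//.
by rewrite ler_wpM2r ?enorm_ge0// polar_norm1.
Qed.

Lemma gauge_le u m : (forall a, polar X a -> dot a u <= m) -> gauge X u <= m.
Proof.
move=> um; apply: ge_sup; last by move=> _ [a Xa <-]; exact: um.
by exists (dot 0 u), 0 => //; exact: polar0.
Qed.

Lemma gauge_ge0 u : 0 <= gauge X u.
Proof. by rewrite -(dot0l u) gauge_ge//; exact: polar0. Qed.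

Lemma gaugeZ t u : 0 <= t -> gauge X (t *: u) = t * gauge X u.
Proof.
move=> t0; apply/eqP; rewrite eq_le; apply/andP; split.
  by apply: gauge_le => a Xa; rewrite dotZr ler_wpM2l// gauge_ge.
have [->|tn0] := eqVneq t 0; first by rewrite mul0r gauge_ge0.
have {t0 tn0}t0 : 0 < t by rewrite lt_def tn0.
rewrite mulrC -ler_pdivlMr//; apply: gauge_le => a Xa.
by rewrite ler_pdivlMr// mulrC -dotZr gauge_ge.
Qed.

Lemma gauge_lip u w :
  gauge X w <= gauge X u + c^-1 * `|w - u|.
Proof.
apply: gauge_le => a Xa.
have -> : w = u + (w - u) by rewrite addrC subrK.
rewrite dotDr lerD ?gauge_ge// [X in `|X - u|]addrC subrK.
rewrite (@le_trans _ _ (norm1 a * `|w - u|))//.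
  by apply: ler_dot => i; rewrite [leRHS]mx_normrE; apply: (le_bigmax _ _ (ord0, i)).
by rewrite ler_wpM2r// polar_norm1.
Qed.

Lemma continuous_gauge : continuous (gauge X).
Proof.
move=> u; apply/(@cvgrPdist_le _ _ _ (nbhs (u : 'rV[R]_n))) => /= e e0.
have ec : 0 < e * c by rewrite mulr_gt0.
have := @nbhsx_ballx R 'rV[R]_n u _ ec; apply: filterS => w.
rewrite -ball_normE /= => uw; rewrite ler_norml.
have {}uw : c^-1 * `|u - w| <= e by rewrite mulrC ler_pdivrMr// ltW.
have := gauge_lip u w; have := gauge_lip w u; rewrite (distrC w u).
by move=> h1 h2; apply/andP; split; lra.
Qed.

End polar.
End convex_hulls.

Section boundary_of_hull.
Context {R : realType}.
Implicit Types n : nat.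

Lemma dot_scale_sub n (a b : 'rV[R]_n) t :
  dot (t *: b - a) (t *: b - a) = t ^+ 2 * dot b b - 2 * (t * dot a b) + dot a a.
Proof. by rewrite dotBl !dotBr !dotZl !dotZr (dotC b a); ring. Qed.

(** The separating functional points from the closest point of [C] to [z],
    which exists by compactness. *)
Lemma separation n (C : set 'rV[R]_n) (z : 'rV[R]_n) :
  @convex_set R 'rV[R]_n C -> closed C -> C !=set0 -> ~ C z ->
  exists a m, (forall k, C k -> dot a k <= m) /\ m < dot a z.
Proof.
move=> cC clC [k0 Ck0] Cz.
have cf : continuous (fun k : 'rV[R]_n => enorm (k - z) ^+ 2).
  move=> x; apply: (@continuous_comp _ _ _ (fun k : 'rV[R]_n => k - z)
      (fun v : 'rV[R]_n => enorm v ^+ 2)); last exact: continuous_sqr_enorm.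
  by apply: (@cvgB _ _ _ (nbhs (x : 'rV[R]_n))); [exact: cvg_id|exact: cvg_cst].
pose A := C `&` [set k | enorm (k - z) ^+ 2 <= enorm (k0 - z) ^+ 2].
have cA : compact A.
  apply: bounded_closed_compact; last first.
    apply: closedI => //.
    exact: (closed_comp (fun x _ => cf x) (@closed_le R (enorm (k0 - z) ^+ 2))).
  exists (enorm (k0 - z) + `|z|); split; first exact: num_real.
  move=> x xe k [_ /=]; rewrite ler_pXn2r ?nnegrE ?enorm_ge0// => kz.
  apply: le_trans (ltW xe); rewrite -[k](subrK z) (le_trans (ler_normD _ _))// lerD2r.
  rewrite (le_trans _ kz)// [leLHS]mx_normrE; apply/bigmax_leP; split.
    exact: enorm_ge0.
  by move=> [i j] _ /=; rewrite ord1 abs_coord_le.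
have A0 : A !=set0 by exists k0; split => /=.
have [p] := EVT_min_rV A0 cA (continuous_subspaceT cf).
rewrite inE => -[Cp pk0] pmin.
have {}pmin k : C k -> enorm (p - z) ^+ 2 <= enorm (k - z) ^+ 2.
  move=> Ck; have [h|/ltW h] := lerP (enorm (k - z) ^+ 2) (enorm (k0 - z) ^+ 2).
    by apply: pmin; rewrite inE.
  exact: le_trans h.
exists (z - p), (dot (z - p) p); split; last first.
  rewrite -subr_gt0 -dotBr -sqr_enorm exprn_gt0// lt_def enorm_ge0 andbT.
  by rewrite enorm_eq0 subr_eq0; apply: contra_notN Cz => /eqP ->.
move=> k Ck; rewrite -subr_le0 -dotBr.
set u := dot _ _; set w := dot (k - p) (k - p).
have w0 : 0 <= w by rewrite /w -sqr_enorm sqr_ge0.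
have H t : 0 <= t <= 1 -> 0 < t -> 2 * u <= t * w.
  move=> t01 t0; have := pmin _ (convex_comb cC Ck Cp t01).
  have -> : t *: k + (1 - t) *: p - z = t *: (k - p) - (z - p).
    by apply/rowP => i; rewrite !mxE; ring.
  have -> : enorm (p - z) = enorm (z - p).
    by rewrite -[LHS]mul1r -normrN1 -enormZ scaleN1r opprB.
  rewrite !sqr_enorm dot_scale_sub -/u -/w => h.
  rewrite -(ler_pM2l t0).
  have -> : t * (2 * u) = 2 * (t * u) by ring.
  have -> : t * (t * w) = t ^+ 2 * w by ring.
  by lra.
rewrite leNgt; apply/negP => u0.
have [w1|w1] := lerP w u.
  by have := H 1; rewrite lexx ler01 ltr01 => /(_ isT isT); lra.
have wp : 0 < w by rewrite (lt_trans u0).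
have uw0 : 0 < u / w by rewrite divr_gt0.
have uw1 : u / w <= 1 by rewrite ler_pdivrMr// mul1r ltW.
have := H (u / w); rewrite uw1 ltW// => /(_ isT uw0).
by rewrite divfK ?gt_eqF//; lra.
Qed.

Section sign_covered.
Variables (n : nat) (X : set 'rV[R]_n) (c : R).
Hypotheses (c0 : 0 < c) (cov : sign_covered c X).

Let K := convex_hull X.

Let convK : @convex_set R 'rV[R]_n K.
Proof. exact: convex_hull_convex. Qed.

Let cube (z : 'rV[R]_n) : (forall i, `|z ord0 i| <= c) -> K z.
Proof. exact: cube_sub_convex_hull. Qed.

Lemma closure_hull_gauge x : closure K x -> gauge X x <= 1.
Proof.
move=> Kx; apply: (gauge_le _) => a Xa.
have cl : closed [set x : 'rV[R]_n | dot a x <= 1].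
  apply: (@closed_comp _ _ (dot a) [set t : R | t <= 1]).
    by move=> y _; exact: continuous_dot.
  exact: closed_le.
suff : closure K `<=` [set x : 'rV[R]_n | dot a x <= 1] by exact.
rewrite closureE; apply: smallest_sub => //.
exact: convex_hull_dot_le.
Qed.

(** Mixing a point near [x] with a small point of the cube recovers [t *: x]. *)
Lemma shrink_closure_hull x t : 0 <= t < 1 -> closure K x -> K (t *: x).
Proof.
move=> /andP[t0 t1] Kx.
have e0 : 0 < (1 - t) * c by rewrite mulr_gt0 ?subr_gt0.
have [y [Ky]] := Kx _ (@nbhsx_ballx R 'rV[R]_n x _ e0).
rewrite -ball_normE /= => xy.
pose z := ((1 - t)^-1 * t) *: (x - y).
have -> : t *: x = t *: y + (1 - t) *: z.
  have t10 : 1 - t != 0 by rewrite subr_eq0 gt_eqF.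
  by apply/rowP => i; rewrite !mxE; field.
apply: convex_comb => //; last by rewrite t0 ltW.
apply: cube => i; rewrite mxE normrM ger0_norm; last first.
  by rewrite mulr_ge0// invr_ge0 subr_ge0 ltW.
rewrite -mulrA ler_pdivrMl ?subr_gt0//.
apply: (@le_trans _ _ (1 * `|(x - y) ord0 i|)).
  by rewrite ler_wpM2r// ltW.
rewrite mul1r; apply: le_trans (ltW xy).
by rewrite [leRHS]mx_normrE; apply: (le_bigmax _ _ (ord0, i)).
Qed.

Lemma convex_closure_hull : @convex_set R 'rV[R]_n (closure K).
Proof.
apply: convex_setP => x y t Kx Ky /andP[t0 t1] B.
rewrite -nbhs_ballE => -[e /= e0 eB].
have [x' [Kx']] := Kx _ (@nbhsx_ballx R 'rV[R]_n x _ e0).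
have [y' [Ky']] := Ky _ (@nbhsx_ballx R 'rV[R]_n y _ e0).
rewrite -!ball_normE /= => yy' xx'.
exists (t *: x' + (1 - t) *: y'); split; first by apply: convex_comb; rewrite ?t0.
apply: eB; rewrite -ball_normE /=.
rewrite (_ : _ - _ = t *: (x - x') + (1 - t) *: (y - y')); last first.
  by apply/rowP => i; rewrite !mxE; ring.
rewrite (le_lt_trans (ler_normD _ _))// !normrZ !ger0_norm ?subr_ge0//.
have [->|tn0] := eqVneq t 0; first by rewrite mul0r add0r subr0 mul1r.
have tp : 0 < t by rewrite lt_def tn0.
by nra.
Qed.

(** A point outside the closed hull is separated from it by a functional, which
    is positive on the point of its own orthant and can thus be normalized to
    be an element of the polar. *)
Lemma gauge_le1_closure_hull x : gauge X x <= 1 -> closure K x.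
Proof.
move=> Xx; apply: contrapT => nKx.
have K0 : closure K !=set0.
  exists 0; apply: subset_closure; apply: cube => i.
  by rewrite mxE normr0 ltW.
have [a [m [Km mx]]] := separation convex_closure_hull (@closed_closure _ _) K0 nKx.
have Xm y : X y -> dot a y <= m.
  by move=> Xy; apply: Km; apply: subset_closure; exact: sub_gen_smallest.
have [y Xy ay] := sign_covered_dot a cov.
have m0 : 0 < m.
  rewrite lt_def (le_trans _ (le_trans ay (Xm _ Xy))) ?mulr_ge0 ?norm1_ge0 ?ltW// andbT.
  apply/negP => /eqP mE.
  have a0 : norm1 a <= 0.
    by rewrite -(ler_pM2l c0) mulr0 -mE (le_trans ay)// Xm.
  have := ler_dot_enorm a x; have := ler_norm (dot a x).
  have := enorm_ge0 x; have := norm1_ge0 a; nra.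
have Xa : polar X (m^-1 *: a).
  by move=> z Xz; rewrite dotZl mulrC ler_pdivrMr// mul1r Xm.
have := gauge_ge c0 cov x Xa.
by rewrite dotZl mulrC ler_pdivrMr//; nra.
Qed.

(** The sublevel set [gauge < 1] is open, and lies in the hull itself, and not
    only in its closure, by [shrink_closure_hull]. *)
Lemma boundary_hull : boundary K = [set x | gauge X x = 1].
Proof.
apply/seteqP; split => x /=.
  move=> [/closure_hull_gauge]; rewrite le_eqVlt => /predU1P[//|x1 nx].
  exfalso; apply: nx.
  have o : open [set y : 'rV[R]_n | gauge X y < 1].
    apply: (@open_comp _ _ (gauge X) [set t : R | t < 1]).
      by move=> y _; exact: (continuous_gauge c0 cov).
    exact: open_lt.
  suff sub : [set y : 'rV[R]_n | gauge X y < 1] `<=` K.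
    by move: sub; rewrite (open_subsetE _ o); exact.
  move=> y /= y1; pose t := (gauge X y + 1) / 2.
  have [t0 t1] : 0 < t /\ t < 1 by have := gauge_ge0 c0 cov y; rewrite /t; lra.
  rewrite -(scale1r y) -(mulfV (lt0r_neq0 t0)) -scalerA.
  apply: shrink_closure_hull; first by rewrite t1 ltW.
  apply: gauge_le1_closure_hull; have ti0 : 0 <= t^-1 by rewrite invr_ge0 ltW.
  rewrite (gaugeZ c0 cov _ ti0) ler_pdivrMl// mulr1 /t; lra.
move=> x1; split; first by apply: gauge_le1_closure_hull; rewrite x1.
rewrite /interior -nbhs_ballE => -[e /= e0 eK].
pose d := e / 2 / (1 + `|x|).
have d0 : 0 < d by rewrite !divr_gt0// ltr_pwDl.
have : K ((1 + d) *: x).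
  apply: eK; rewrite -ball_normE /= (_ : x - _ = - (d *: x)); last first.
    by rewrite scalerDl scale1r opprD addNKr.
  rewrite normrN normrZ gtr0_norm// /d mulrAC ltr_pdivrMr ?ltr_pwDl//.
  by have := normr_ge0 x; nra.
move=> /subset_closure /closure_hull_gauge; rewrite (gaugeZ c0 cov) ?x1; lra.
Qed.

End sign_covered.
End boundary_of_hull.

(** * The exponential map of the sphere *)

Section trigonometry.
Context {R : realType}.
Implicit Types x t : R.

Lemma sin_mvt x : 0 <= x -> exists2 y, 0 <= y <= x & sin x = cos y * x.
Proof.
move=> x0; have [|c] := @MVT_segment R sin cos 0 x x0 (fun y _ => is_derive_sin y).
  by apply: continuous_subspaceT => y; exact: continuous_sin.
by rewrite in_itv/= sin0 !subr0; exists c.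
Qed.

Lemma sin_le_id x : 0 <= x -> `|sin x| <= x.
Proof.
move=> x0; have [y _ ->] := sin_mvt x0.
by rewrite normrM (ger0_norm x0) ler_piMl// cos_max.
Qed.

Lemma oneBcos x : 1 - cos x = 2 * sin (x / 2) ^+ 2.
Proof.
have {1}-> : x = (x / 2) *+ 2 by rewrite -mulr_natr divfK.
by rewrite cos_mulr2n cos2sin2 -mulr_natr; ring.
Qed.

Lemma cos_ge x : 0 <= x -> 1 - x ^+ 2 / 2 <= cos x.
Proof.
move=> x0; have := oneBcos x; have := @sin_le_id (x / 2).
rewrite divr_ge0// => /(_ isT); rewrite ler_norml => /andP[h1 h2]; nra.
Qed.

Lemma sin_ge x : 0 <= x -> x * (1 - x ^+ 2 / 2) <= sin x.
Proof.
move=> x0; have [y /andP[y0 yx] ->] := sin_mvt x0.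
rewrite mulrC ler_wpM2r//; apply: le_trans (cos_ge y0).
by rewrite lerB// ler_pM2r// ler_pXn2r.
Qed.

(** From [1 - cos x = 2 sin^2 (x / 2)] and the lower bound on the sine, which is
    only useful while that bound is nonnegative. *)
Lemma cos_le x : 0 <= x -> cos x <= 1 - x ^+ 2 / 2 + x ^+ 4 / 8.
Proof.
move=> x0; pose y := x / 2; have y0 : 0 <= y by rewrite divr_ge0.
have h : y ^+ 2 - y ^+ 4 <= sin y ^+ 2.
  have [y1|y1] := lerP y 1.
    have := sin_ge y0; have := sqr_ge0 (y ^+ 3) => h1 h2.
    have : 0 <= y * (1 - y ^+ 2 / 2) by rewrite mulr_ge0//; nra.
    move=> h3; rewrite (@le_trans _ _ ((y * (1 - y ^+ 2 / 2)) ^+ 2))//; first by lra.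
    by rewrite ler_pXn2r// nnegrE; lra.
  apply: le_trans (sqr_ge0 _).
  rewrite subr_le0 -[4%N]/(2 + 2)%N exprD ler_peMl ?sqr_ge0//.
  by rewrite -(expr1n _ 2) ler_pXn2r ?nnegrE// ltW.
have := oneBcos x; rewrite -/y => h2.
have yx : y ^+ 2 = x ^+ 2 / 4 by rewrite /y expr_div_n; congr (_ / _); lra.
have yx4 : y ^+ 4 = x ^+ 4 / 16 by rewrite /y expr_div_n; congr (_ / _); lra.
by lra.
Qed.

(** In other words, [x <= tan x] before [pi / 2]. *)
Lemma mul_cos_le_sin x : 0 <= x <= pi -> x * cos x <= sin x.
Proof.
move=> /andP[x0 xpi]; have [y /andP[y0 yx] ->] := sin_mvt x0.
rewrite mulrC ler_wpM2r//; have [->//|ynx] := eqVneq y x.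
rewrite ltW// ltr_cos ?in_itv/= ?x0 ?y0 ?xpi//; last exact: le_trans xpi.
by rewrite lt_neqAle ynx.
Qed.

(** The extension of [sin t / t] by continuity: with it, the exponential map is
    given by a single formula that is continuous at the origin. *)
Definition sinc t : R := if t == 0 then 1 else sin t / t.

Lemma sincE t : sinc t * t = sin t.
Proof.
rewrite /sinc; have [->|t0] := eqVneq t 0; first by rewrite mulr0 sin0.
by rewrite divfK.
Qed.

Lemma sinc_bounds t : 0 <= t -> 1 - t ^+ 2 / 2 <= sinc t <= 1.
Proof.
rewrite /sinc; have [->|tn0 t0] := eqVneq t 0.
  by rewrite expr0n/= mul0r subr0 !lexx.
have {tn0}t0' : 0 < t by rewrite lt_def tn0.
rewrite ler_pdivlMr// ler_pdivrMr// mul1r mulrC sin_ge//=.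
exact: le_trans (ler_norm _) (sin_le_id _).
Qed.

Lemma continuous_sinc : continuous sinc.
Proof.
move=> t; have [->|t0] := eqVneq t 0.
  have s0 : sinc 0 = 1 by rewrite /sinc eqxx.
  rewrite /continuous_at s0; apply/(@cvgrPdist_le _ _ _ (nbhs (0 : R))) => e e0.
  have e1 : 0 < Num.min 1 e by rewrite lt_min ltr01.
  exists (Num.min 1 e) => // x /=; rewrite sub0r normrN lt_min => /andP[/ltW x1 /ltW xe].
  have /sinc_bounds/andP[h1 h2] : 0 <= `|x| by [].
  have -> : sinc x = sinc `|x|.
    rewrite /sinc normr_eq0; case: eqVneq => // _.
    by case: (ger0P x) => x0 //; rewrite sinN invrN mulrNN.
  rewrite ger0_norm ?subr_ge0//.
  suff : `|x| ^+ 2 <= e by have := sqr_ge0 `|x|; lra.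
  by have := normr_ge0 x; nra.
have h : sin x / x @[x --> t] --> sin t / t.
  by apply: cvgM; [exact: continuous_sin|apply: cvgV => //; exact: cvg_id].
rewrite /continuous_at {2}/sinc (negbTE t0); apply: cvg_trans h.
apply: near_eq_cvg; apply: (filterS _ (open_nbhs_nbhs (conj (@open_neq _ 0) t0))).
by move=> x /= /negbTE x0; rewrite /sinc x0.
Qed.

End trigonometry.

Section exponential_map.
Context {R : realType}.
Variable n : nat.
Implicit Types v w : 'rV[R]_n.

Lemma rv_last_south : rv_last (- north R n) = -1.
Proof. by rewrite -scaleN1r rv_lastZ rv_last_rcons mulr1. Qed.

Lemma rv_head_south : rv_head (- north R n) = 0.
Proof. by rewrite -scaleN1r rv_headZ rv_head_rcons scaler0. Qed.

Lemma rv_last_exp_map v : rv_last (exp_map v) = cos (enorm v).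
Proof. by rewrite /rv_last !mxE unlift_none/= mulr1 mulr0 addr0. Qed.

Lemma rv_head_exp_map v : rv_head (exp_map v) = sinc (enorm v) *: v.
Proof.
apply/rowP => j; rewrite !mxE liftK/= mxE mulr0 add0r.
have [v0|v0] := eqVneq (enorm v) 0; last by rewrite /sinc (negbTE v0) mxE mulrA.
by move/eqP: v0; rewrite enorm_eq0 => /eqP ->; rewrite !mxE !mulr0.
Qed.

Lemma enorm_exp_map v : enorm (exp_map v) = 1.
Proof.
apply: enorm_eq => //; rewrite -sqr_enorm sqr_enorm_split rv_last_exp_map.
rewrite rv_head_exp_map enormZ exprMn real_normK ?num_real// -exprMn sincE.
by rewrite addrC cos2Dsin2 expr1n.
Qed.

Lemma exp_map_inj v w : enorm v < pi -> enorm w < pi ->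
  exp_map v = exp_map w -> v = w.
Proof.
move=> vpi wpi vw.
have nvw : enorm v = enorm w.
  apply: cos_inj; rewrite ?in_itv/= ?enorm_ge0 ?ltW//.
  by rewrite -!rv_last_exp_map vw.
have := congr1 (@rv_head R n) vw; rewrite !rv_head_exp_map nvw.
apply: scalerI.
rewrite /sinc; have [_|w0] := eqVneq (enorm w) 0; first exact: oner_neq0.
rewrite mulf_eq0 invr_eq0 (negbTE w0) orbF.
by rewrite gt_eqF// sin_gt0_pi// wpi andbT lt_def w0 enorm_ge0.
Qed.

Lemma exp_map_surj (u : 'rV[R]_n.+1) : enorm u = 1 -> u != - north R n ->
  exists2 v, enorm v < pi & exp_map v = u.
Proof.
move=> u1 uN; have e1 := sqr_enorm_split u; rewrite u1 expr1n in e1.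
have h0 := sqr_ge0 (enorm (rv_head u)).
have ul : -1 <= rv_last u <= 1 by apply/andP; split; nra.
have [hu|hu] := eqVneq (enorm (rv_head u)) 0.
  exists 0; first by rewrite enorm0 pi_gt0.
  have {}hu : rv_head u = 0 by apply/eqP; rewrite -enorm_eq0 hu.
  apply: rv_eq; first by rewrite rv_head_exp_map scaler0 hu.
  rewrite rv_last_exp_map enorm0 cos0.
  move: e1; rewrite hu enorm0 expr0n/= add0r => /esym/eqP.
  rewrite sqrf_eq1 => /orP[/eqP ->//|/eqP uN1]; exfalso; move/eqP: uN; apply.
  by apply: rv_eq; rewrite ?rv_head_south ?rv_last_south.
have ulm : -1 < rv_last u.
  case/andP: ul; rewrite le_eqVlt => /predU1P[uE|//] _; exfalso.
  by move/eqP: hu; apply; move: e1; rewrite -uE sqrrN expr1n; nra.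
set h := enorm (rv_head u) in hu e1 h0.
have hp : 0 < h by rewrite lt_def hu enorm_ge0.
pose t := acos (rv_last u).
have st : sin t = h.
  rewrite sin_acos//; have -> : 1 - rv_last u ^+ 2 = h ^+ 2 by lra.
  by rewrite sqrtr_sqr gtr0_norm.
have nt : enorm ((t / h) *: rv_head u) = t.
  have th0 : 0 <= t / h by rewrite divr_ge0 ?(ltW hp)//; exact: acos_ge0.
  by rewrite enormZ -/h ger0_norm// divfK.
exists ((t / h) *: rv_head u).
  by rewrite nt acos_ltpi// ulm; case/andP: ul.
apply: rv_eq; last by rewrite rv_last_exp_map nt acosK.
by rewrite rv_head_exp_map nt scalerA mulrA sincE st divff// scale1r.
Qed.

Lemma exp_map_neq_south v : enorm v < pi -> exp_map v != - north R n.
Proof.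
move=> vpi; apply/eqP => /(congr1 (@rv_last R n)); rewrite rv_last_exp_map.
rewrite rv_last_south -cospi => /cos_inj.
rewrite !in_itv/= enorm_ge0 lexx pi_ge0 ltW// => /(_ isT isT) vE.
by rewrite vE ltxx in vpi.
Qed.

Lemma exp_mapK v : enorm v < pi -> exp_map_inv (exp_map v) = v.
Proof.
move=> vpi; rewrite /exp_map_inv (negbTE (exp_map_neq_south vpi)).
case: xgetP => [w _ [wpi wv]|/(_ v)[]//]; exact: exp_map_inj.
Qed.

(** At the south pole, the conventional value has norm [pi] as soon as it has a
    coordinate, and all the vectors of norm [pi] are mapped to that pole. *)
Lemma exp_map_inv_spec (u : 'rV[R]_n.+1) : (0 < n)%N -> enorm u = 1 ->
  enorm (exp_map_inv u) <= pi /\ exp_map (exp_map_inv u) = u.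
Proof.
move=> n0 u1; rewrite /exp_map_inv; case: ifPn => [/eqP ->|uN].
  set v : 'rV[R]_n := \row_i _.
  have vpi : enorm v = pi.
    apply: enorm_eq; first exact: pi_ge0.
    case: n n0 @v => // m _ v.
    rewrite dot_split (_ : rv_head v = 0) ?dot0l ?add0r.
      by rewrite /rv_last mxE/= eqxx.
    apply/rowP => j; rewrite !mxE lift_max eqn_leq; case: ifP => // /andP[_].
    by rewrite ltnS leqNgt ltn_ord.
  split; first by rewrite vpi.
  apply: rv_eq.
    rewrite rv_head_exp_map vpi /sinc gt_eqF ?pi_gt0// sinpi mul0r scale0r.
    by rewrite rv_head_south.
  by rewrite rv_last_exp_map vpi cospi rv_last_south.
have [v vpi vu] := exp_map_surj u1 uN.
by case: xgetP => [w _ [/ltW wpi //]|/(_ v)[]].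
Qed.

Lemma continuous_exp_map_coord i : continuous (fun v => exp_map v ord0 i).
Proof.
case: (unliftP ord_max i) => [j|] ->.
  rewrite (_ : (fun v => _) = fun v : 'rV[R]_n => sinc (enorm v) * v ord0 j).
    move=> v; apply: (@cvgM _ _ (nbhs (v : 'rV[R]_n))).
      apply: (@continuous_comp _ _ _ (@enorm R n) sinc).
        exact: continuous_enorm.
      exact: continuous_sinc.
    exact: (@coord_continuous R 1 n ord0 j v).
  apply/funext => v; have := congr1 (fun u : 'rV[R]_n => u ord0 j) (rv_head_exp_map v).
  by rewrite !mxE.
rewrite (_ : (fun v => _) = fun v : 'rV[R]_n => cos (enorm v)).
  move=> v; apply: (@continuous_comp _ _ _ (@enorm R n) cos).
    exact: continuous_enorm.
  exact: continuous_cos.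
by apply/funext => v; exact: rv_last_exp_map.
Qed.

Lemma continuous_exp_map : continuous (@exp_map R n).
Proof.
move=> v A [B /= vB BA].
apply: (@filterS _ (nbhs (v : 'rV[R]_n)) _ [set w | forall i, B ord0 i (exp_map w ord0 i)]).
  by move=> w wB; apply: BA => i j; rewrite ord1.
apply: (@filter_forall _ _ (fun i w => B ord0 i (exp_map w ord0 i))
  (nbhs (v : 'rV[R]_n))) => i.
exact: (@continuous_exp_map_coord i v _ (vB ord0 i)).
Qed.

End exponential_map.

(** * The scaling transform in Cartesian coordinates *)

(** The scaling transform with the radius [r] as a parameter: [scaling lambda] is
    [scaling_by (scaling_radius n lambda)]. *)
Definition scaling_by (R : realType) n (r : R) (x : 'rV[R]_n.+1) : 'rV[R]_n * R :=
  if x == 0 then (0, r ^+ 2)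
  else (r *: exp_map_inv ((enorm x)^-1 *: x), r ^+ 2 * (1 - enorm x / r)).

(** Cartesian coordinates around the point at distance [r] towards the north
    pole, with the vertical direction reversed and magnified by [r]: an affine
    map, hence compatible with convex hulls. *)
Definition flat (R : realType) n (r : R) (x : 'rV[R]_n.+1) : 'rV[R]_n * R :=
  (rv_head x, r ^+ 2 - r * rv_last x).

(** This is the limit of [flat r] read through the scaling transform; it maps the
    paraboloids to half-spaces. *)
Definition unbend (R : realType) n (w : 'rV[R]_n * R) : 'rV[R]_n * R :=
  (w.1, w.2 + enorm w.1 ^+ 2 / 2).

Section scaling_geometry.
Context {R : realType}.
Variable n : nat.
Implicit Types (v s : 'rV[R]_n) (x : 'rV[R]_n.+1) (r : R).

Lemma scaling_by_polar r x : (0 < n)%N -> 0 < r -> x != 0 ->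
  x = (r - (scaling_by r x).2 / r) *: exp_map (r^-1 *: (scaling_by r x).1).
Proof.
move=> n0 r0 x0; rewrite /scaling_by (negbTE x0)/=.
have ex0 : 0 < enorm x by rewrite lt_def enorm_eq0 x0 enorm_ge0.
rewrite scalerA mulVf ?gt_eqF// scale1r (exp_map_inv_spec _ _).2//; last first.
  by rewrite enormZ gtr0_norm ?invr_gt0// mulVf ?gt_eqF.
rewrite scalerA -[LHS]scale1r; congr (_ *: _).
have rn0 : r != 0 by rewrite gt_eqF.
have en0 : enorm x != 0 by rewrite gt_eqF.
by field; rewrite ?rn0 ?en0.
Qed.

Lemma scaling_by_height r x : 0 < r -> x != 0 ->
  r - (scaling_by r x).2 / r = enorm x.
Proof.
move=> r0 x0; rewrite /scaling_by (negbTE x0)/=.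
have rn0 : r != 0 by rewrite gt_eqF.
by field.
Qed.

Lemma scaling_by_exp r rho v : 0 < r -> 0 < rho -> enorm v < pi * r ->
  scaling_by r (rho *: exp_map (r^-1 *: v)) = (v, r ^+ 2 * (1 - rho / r)).
Proof.
move=> r0 rho0 vpi; rewrite /scaling_by.
have e : enorm (rho *: exp_map (r^-1 *: v)) = rho.
  by rewrite enormZ enorm_exp_map mulr1 gtr0_norm.
rewrite -enorm_eq0 e gt_eqF// scalerA mulVf ?gt_eqF// scale1r exp_mapK.
  by rewrite scalerA divff ?gt_eqF// scale1r.
by rewrite enormZ gtr0_norm ?invr_gt0// mulrC ltr_pdivrMr.
Qed.

Lemma angle_ge0 r v : 0 < r -> 0 <= enorm v / r.
Proof. by move=> r0; rewrite divr_ge0 ?enorm_ge0// ltW. Qed.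

Lemma enorm_angle r v : 0 < r -> enorm (r^-1 *: v) = enorm v / r.
Proof. by move=> r0; rewrite enormZ gtr0_norm ?invr_gt0// mulrC. Qed.

Lemma sinc_angle r v M : 0 < r -> enorm v <= M ->
  1 - M ^+ 2 / 2 / r ^+ 2 <= sinc (enorm v / r) <= 1.
Proof.
move=> r0 vM; have /andP[h1 ->] := sinc_bounds (angle_ge0 v r0).
rewrite andbT; apply: le_trans h1; rewrite lerB// expr_div_n.
rewrite mulrAC ler_pM2r ?invr_gt0 ?exprn_gt0// ler_pM2r// ler_pXn2r ?nnegrE ?enorm_ge0//.
exact: le_trans (enorm_ge0 v) vM.
Qed.

Lemma abs_sinc_le1 (t : R) : 0 <= t -> `|sinc t| <= 1.
Proof.
rewrite /sinc; have [_ _|t0' t0] := eqVneq t 0; first by rewrite normr1.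
rewrite normf_div (ger0_norm t0) ler_pdivrMr ?mul1r ?sin_le_id//.
by rewrite lt_def t0'.
Qed.

Lemma cos_angle r v M : 0 < r -> enorm v <= M ->
  enorm v ^+ 2 / 2 - M ^+ 4 / 8 / r ^+ 2 <= r ^+ 2 * (1 - cos (enorm v / r))
    <= enorm v ^+ 2 / 2.
Proof.
move=> r0 vM; have t0 := angle_ge0 v r0.
have := cos_ge t0; have := cos_le t0; rewrite !expr_div_n => h1 h2.
have r2 : 0 < r ^+ 2 by rewrite exprn_gt0.
have v4 : enorm v ^+ 4 <= M ^+ 4.
  by rewrite ler_pXn2r ?nnegrE ?enorm_ge0// (le_trans (enorm_ge0 v)).
have e1 : r ^+ 2 * (enorm v ^+ 2 / r ^+ 2 / 2) = enorm v ^+ 2 / 2.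
  by field; rewrite gt_eqF.
have e2 : r ^+ 2 * (enorm v ^+ 4 / r ^+ 4 / 8) = enorm v ^+ 4 / 8 / r ^+ 2.
  by field; rewrite gt_eqF.
have e3 : enorm v ^+ 4 / 8 / r ^+ 2 <= M ^+ 4 / 8 / r ^+ 2.
  by rewrite ler_pM2r ?invr_gt0// ler_pM2r.
apply/andP; split.
  rewrite (@le_trans _ _ (r ^+ 2 * (enorm v ^+ 2 / r ^+ 2 / 2 - enorm v ^+ 4 / r ^+ 4 / 8)))//.
    by rewrite mulrBr e1 e2; lra.
  by rewrite ler_pM2l//; lra.
by rewrite -e1 ler_pM2l//; lra.
Qed.

(** On a bounded window the spherical coordinates and the Cartesian ones of a
    point differ by the paraboloid correction, up to an error of order r^-2. *)
Lemma flat_close r M H x : (0 < n)%N -> 1 <= r -> 0 <= M -> 0 <= H ->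
  x != 0 -> enorm (scaling_by r x).1 <= M -> `|(scaling_by r x).2| <= H ->
  let C := (M ^+ 2 / 2 + H) * M + M ^+ 4 / 8 + H * M ^+ 2 in
  (forall i, `|(flat r x).1 ord0 i - (unbend (scaling_by r x)).1 ord0 i| <= C / r ^+ 2)
  /\ `|(flat r x).2 - (unbend (scaling_by r x)).2| <= C / r ^+ 2.
Proof.
move=> n0 r1 M0 H0 x0 vM hH C; have r0 : 0 < r by rewrite (lt_le_trans ltr01).
have := scaling_by_polar n0 r0 x0.
case: (scaling_by r x) vM hH => v h /= vM hH xE; rewrite {}xE rv_headZ rv_lastZ.
rewrite rv_head_exp_map rv_last_exp_map enorm_angle//.
have /andP[s1 s2] := sinc_angle r0 vM.
have /andP[c1 c2] := cos_angle r0 vM.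
set sc := sinc _ in s1 s2 *; set co := cos _ in c1 c2 *.
have r2 : 0 < r ^+ 2 by rewrite exprn_gt0.
have rn0 : r != 0 by rewrite gt_eqF.
set z := (r ^+ 2)^-1 in s1 c1 *; have z0 : 0 < z by rewrite invr_gt0.
have rz : r ^+ 2 * z = 1 by rewrite divff// gt_eqF.
have z1 : z <= 1 by rewrite invf_le1// exprn_ege1.
have M2 := sqr_ge0 M; have vM2 : enorm v ^+ 2 <= M ^+ 2.
  by rewrite ler_pXn2r ?nnegrE ?enorm_ge0.
move: hH; rewrite ler_norml => /andP[hH1 hH2].
have C1 : 0 <= (M ^+ 2 / 2 + H) * M by rewrite mulr_ge0// addr_ge0// divr_ge0.
have C2 : 0 <= M ^+ 4 by rewrite exprn_ge0.
have C3 : 0 <= H * M ^+ 2 by rewrite mulr_ge0.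
split.
  move=> i; rewrite !mxE.
  have -> : (r - h / r) * (sc * (r^-1 * v ord0 i)) - v ord0 i
            = ((1 - h * z) * sc - 1) * v ord0 i by rewrite /z; field.
  rewrite normrM; apply: (@le_trans _ _ (((M ^+ 2 / 2 + H) * z) * M)); last first.
    by rewrite /C mulrAC ler_pM2r//; lra.
  apply: ler_pM => //; last exact: le_trans (abs_coord_le _ _) vM.
  have sc1 : `|sc| <= 1 by apply: abs_sinc_le1; exact: angle_ge0.
  have -> : (1 - h * z) * sc - 1 = (sc - 1) - h * (z * sc) by ring.
  rewrite (le_trans (ler_normB _ _))// mulrDl lerD//.
    by rewrite ler_norml; apply/andP; split; nra.
  rewrite !normrM (gtr0_norm z0) ler_pM ?mulr_ge0 ?(ltW z0)// ?ler_norml ?hH1//.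
  by rewrite ler_piMr// ltW.
have -> : r ^+ 2 - r * ((r - h / r) * co) - (h + enorm v ^+ 2 / 2)
          = (r ^+ 2 * (1 - co) - enorm v ^+ 2 / 2) - h * (1 - co) by field.
have co1 : 0 <= 1 - co by rewrite subr_ge0 cos_le1.
have coM : (1 - co) <= M ^+ 2 * z.
  have -> : 1 - co = z * (r ^+ 2 * (1 - co)) by rewrite mulrA (mulrC z) rz mul1r.
  by rewrite mulrC ler_pM2r//; lra.
rewrite (le_trans (ler_normB _ _))//.
have t1 : `|r ^+ 2 * (1 - co) - enorm v ^+ 2 / 2| <= M ^+ 4 / 8 * z.
  by rewrite ler_norml; apply/andP; split; nra.
have t2 : `|h * (1 - co)| <= H * (M ^+ 2 * z).
  by rewrite normrM (ger0_norm co1) ler_pM// ler_norml hH1.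
have t3 : 0 <= (M ^+ 2 / 2 + H) * M * z by rewrite mulr_ge0// ltW.
by rewrite /C -/z; lra.
Qed.

(** Conversely, a point whose Cartesian coordinates are in a bounded window has
    its spherical coordinates in one, since [theta <= tan theta]. *)
Lemma flat_window r M A Q x : (0 < n)%N -> 0 < r -> 2 * Q <= r ^+ 2 ->
  enorm (flat r x).1 <= M -> - A <= (flat r x).2 <= Q ->
  [/\ x != 0, enorm (scaling_by r x).1 <= 2 * M
    & - A - M ^+ 2 <= (scaling_by r x).2 <= Q].
Proof.
move=> n0 r0 rQ /= hM /andP[qA qQ].
have r2 : 0 < r ^+ 2 by rewrite exprn_gt0.
have xl : r / 2 <= rv_last x.
  by rewrite -(ler_pM2l r0); nra.
have xl0 : 0 < rv_last x by rewrite (lt_le_trans _ xl)// divr_gt0.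
have x0 : x != 0 by apply: contraTneq xl0 => ->; rewrite /rv_last mxE ltxx.
have ex0 : 0 < enorm x by rewrite lt_def enorm_eq0 x0 enorm_ge0.
have hE := scaling_by_height r0 x0.
have vpi : enorm (scaling_by r x).1 <= pi * r.
  rewrite /scaling_by (negbTE x0)/= enormZ gtr0_norm// mulrC ler_pM2r//.
  apply: (exp_map_inv_spec _ _).1 => //.
  by rewrite enormZ gtr0_norm ?invr_gt0// mulVf ?gt_eqF.
have xE := scaling_by_polar n0 r0 x0; rewrite hE in xE.
have cE : enorm x * cos (enorm (scaling_by r x).1 / r) = rv_last x.
  by rewrite {3}xE rv_lastZ rv_last_exp_map enorm_angle.
have sE : enorm x * sin (enorm (scaling_by r x).1 / r) = enorm (rv_head x).
  have t0 := angle_ge0 (scaling_by r x).1 r0.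
  have tpi : enorm (scaling_by r x).1 / r <= pi by rewrite ler_pdivrMr.
  rewrite {3}xE rv_headZ rv_head_exp_map enorm_angle// !enormZ gtr0_norm//.
  rewrite (gtr0_norm (_ : 0 < r^-1)) ?invr_gt0// (mulrC r^-1).
  rewrite -[X in _ = _ * (_ * X)](ger0_norm t0) -normrM sincE ger0_norm//.
  by rewrite sin_ge0_pi// t0.
have sp := sqr_enorm_split x.
have h1 : (scaling_by r x).2 = r ^+ 2 - r * enorm x.
  by rewrite -hE; field; rewrite gt_eqF.
set h := (scaling_by r x).2 in h1 *; set v := (scaling_by r x).1 in vpi cE sE *.
have hd0 := enorm_ge0 (rv_head x).
have xx : rv_last x <= enorm x by nra.
have M0 : 0 <= M by rewrite (le_trans hd0).
have M2 : enorm (rv_head x) ^+ 2 <= M ^+ 2.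
  by apply: lerXn2r; rewrite ?nnegrE.
split => //.
  have t0 := angle_ge0 v r0.
  have tpi : enorm v / r <= pi by rewrite ler_pdivrMr.
  have := @mul_cos_le_sin R (enorm v / r); rewrite t0 tpi => /(_ isT).
  rewrite -(ler_pM2l ex0) mulrCA cE sE => h2.
  have : enorm v / r * (r / 2) <= M.
    by apply: le_trans hM; apply: le_trans h2; rewrite ler_wpM2l.
  by rewrite mulrA divfK ?gt_eqF//; lra.
have h3 : enorm x - rv_last x <= M ^+ 2 / r.
  rewrite ler_pdivlMr//.
  have : (enorm x - rv_last x) * (enorm x + rv_last x) <= M ^+ 2 by nra.
  by apply: le_trans; rewrite ler_wpM2l ?subr_ge0//; lra.
rewrite h1; apply/andP; split; last by nra.
have : r * (enorm x - rv_last x) <= M ^+ 2 by rewrite mulrC -ler_pdivlMr.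
by lra.
Qed.

End scaling_geometry.

(** * Affine minorants *)

Definition minorant (R : realType) n (Z : set ('rV[R]_n * R)) (b : R)
    (s : 'rV[R]_n) : Prop :=
  forall z, Z z -> b + dot s z.1 <= z.2.

(** The normal vector, scaled as an element of the polar, of the half-space that
    [flat r] maps to the epigraph of [b + dot s]. *)
Definition polar_point (R : realType) n (r b : R) (s : 'rV[R]_n) : 'rV[R]_n.+1 :=
  rv_rcons ((r ^+ 2 - b)^-1 *: s) (r / (r ^+ 2 - b)).

(** A point of the second kind cannot prevent [b + dot s] from being a minorant
    when [b <= q] and the slope [s] has norm at most [S]. *)
Definition close_or_high (R : realType) n (q S d : R)
    (Z Z' : set ('rV[R]_n * R)) : Prop :=
  forall z', Z' z' ->
    (exists2 z, Z z & (forall i, `|z.1 ord0 i - z'.1 ord0 i| <= d)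
                      /\ `|z.2 - z'.2| <= d)
    \/ q + S * enorm z'.1 <= z'.2.

(** The ray of direction [u] leaves the hull at distance [(gauge X u)^-1], whose
    height coordinate in the scaling transform is this one. *)
Definition hull_height (R : realType) n (r : R) (X : set 'rV[R]_n.+1)
    (v : 'rV[R]_n) : R :=
  r ^+ 2 - r / gauge X (exp_map (r^-1 *: v)).

Section minorants.
Context {R : realType}.
Variable n : nat.
Implicit Types (v s : 'rV[R]_n) (X : set 'rV[R]_n.+1) (Z : set ('rV[R]_n * R)).

Lemma dot_polar_point (r b : R) s (x : 'rV[R]_n.+1) :
  dot (polar_point r b s) x = (dot s (rv_head x) + r * rv_last x) / (r ^+ 2 - b).
Proof.
rewrite dot_split rv_head_rcons rv_last_rcons dotZl mulrDl.
by congr (_ + _); [rewrite mulrC|rewrite mulrAC].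
Qed.

(** The origin has the flattened coordinates (0, r^2): it is strictly above the
    graph of [b + dot s] exactly when [b < r ^+ 2]. *)
Lemma polar_minorant (r b : R) s X : b < r ^+ 2 ->
  polar X (polar_point r b s) <-> minorant (flat r @` X) b s.
Proof.
move=> br; have d0 : 0 < r ^+ 2 - b by rewrite subr_gt0.
split=> h.
  by move=> _ [x Xx <-] /=; have := h x Xx; rewrite dot_polar_point ler_pdivrMr//; lra.
move=> x Xx; rewrite dot_polar_point ler_pdivrMr// mul1r.
by have /= := h (flat r x) (imageP _ Xx); lra.
Qed.

Lemma polar_pointP (r : R) (a : 'rV[R]_n.+1) : 0 < r -> 0 < rv_last a ->
  exists b s, b < r ^+ 2 /\ a = polar_point r b s.
Proof.
move=> r0 a0; exists (r ^+ 2 - r / rv_last a), ((r / rv_last a) *: rv_head a).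
have ra : 0 < r / rv_last a by rewrite divr_gt0.
have rn0 : r != 0 by rewrite gt_eqF.
have an0 : rv_last a != 0 by rewrite gt_eqF.
split; first lra.
rewrite /polar_point subKr -[LHS]rv_rconsK; congr rv_rcons.
  by rewrite scalerA mulVf ?gt_eqF// scale1r.
by rewrite invf_div mulrCA divff ?mulr1.
Qed.

(** Evaluate the minorant at the point of the orthant of its slope. *)
Lemma minorant_slope Z c q b s : 0 <= c -> minorant Z b s ->
  sign_covered c [set z.1 | z in Z `&` [set z | z.2 <= q]] ->
  b + c * norm1 s <= q.
Proof.
move=> c0 Zb /(sign_covered_dot s)[_ [z [Zz zq] <-] h].
by have := Zb _ Zz; rewrite /= in zq; lra.
Qed.

(** A minorant of [Z] stays one, up to a small downward shift, of any set whose
    points are either close to [Z] or above every admissible affine function. *)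
Lemma minorant_transfer Z Z' b s (S q d : R) : 0 <= d -> norm1 s <= S -> b <= q ->
  minorant Z b s -> close_or_high q S d Z Z' ->
  minorant Z' (b - d * (1 + S)) s.
Proof.
move=> d0 sS bq Zb ZZ' z' /ZZ'[[z Zz [z1]]|z'far].
  rewrite ler_norml => /andP[z2 z2'].
  have := Zb _ Zz; rewrite -[z.1](subrK z'.1) dotDr.
  have /(ler_abs_dot s) : forall i, `|(z.1 - z'.1) ord0 i| <= d.
    by move=> i; rewrite !mxE.
  by rewrite ler_norml => /andP[h1 h2]; nra.
have := ler_dot_enorm s z'.1; rewrite ler_norml => /andP[_ h].
have := enorm_ge0 z'.1; have := norm1_ge0 s; nra.
Qed.

Lemma dot_polar_point_exp (r b : R) s v : 0 < r -> b < r ^+ 2 ->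
  dot (polar_point r b s) (exp_map (r^-1 *: v)) =
  (r ^+ 2 + (sinc (enorm v / r) * dot s v - r ^+ 2 * (1 - cos (enorm v / r))))
    / (r * (r ^+ 2 - b)).
Proof.
move=> r0 br; rewrite dot_polar_point rv_head_exp_map rv_last_exp_map enorm_angle//.
have rn0 : r != 0 by rewrite gt_eqF.
have dn0 : r ^+ 2 - b != 0 by rewrite gt_eqF// subr_gt0.
by rewrite !dotZr; field; rewrite rn0 dn0.
Qed.

(** The ray of direction [v] meets the hyperplane at a height
    r^2 (k + b) / (r^2 + k), where k tends to [dot s v - enorm v ^+ 2 / 2] and
    is bounded by K, so that the denominator only contributes an error of order
    r^-2. *)
Lemma ray_height_close (r b S B L : R) s v : 1 <= r -> 0 <= L -> 0 <= S ->
  enorm v <= L -> norm1 s <= S -> `|b| <= B -> b < r ^+ 2 ->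
  2 * (S * L + L ^+ 2 / 2) <= r ^+ 2 ->
  let u := exp_map (r^-1 *: v) in
  let K := S * L + L ^+ 2 / 2 in
  let C := 2 * (K + B) * K + S * L * (L ^+ 2 / 2) + L ^+ 4 / 8 in
  0 < dot (polar_point r b s) u /\
  `|r ^+ 2 - r / dot (polar_point r b s) u - (b + dot s v - enorm v ^+ 2 / 2)|
    <= C / r ^+ 2.
Proof.
move=> r1 L0 S0 vL sS bB br rK u K C.
have r0 : 0 < r by rewrite (lt_le_trans ltr01).
rewrite /u dot_polar_point_exp//.
have /andP[s1 s2] := sinc_angle r0 vL.
have /andP[c1 c2] := cos_angle r0 vL.
have sc1 : `|sinc (enorm v / r)| <= 1 by apply: abs_sinc_le1; exact: angle_ge0.
have c3 : 0 <= r ^+ 2 * (1 - cos (enorm v / r)).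
  by rewrite mulr_ge0 ?sqr_ge0// subr_ge0 cos_le1.
set sc := sinc _ in s1 s2 sc1 *; set co := r ^+ 2 * (1 - _) in c1 c2 c3 *.
have r2 : 0 < r ^+ 2 by rewrite exprn_gt0.
have svL : `|dot s v| <= S * L.
  by rewrite (le_trans (ler_dot_enorm _ _))// ler_pM ?norm1_ge0 ?enorm_ge0.
have vL2 : enorm v ^+ 2 <= L ^+ 2 by apply: lerXn2r; rewrite ?nnegrE ?enorm_ge0.
set k := sc * dot s v - co.
have kK : `|k| <= K.
  rewrite /k (le_trans (ler_normB _ _))// lerD//; last by rewrite ger0_norm//; lra.
  by rewrite normrM -[leRHS]mul1r ler_pM.
have K0 : 0 <= K by rewrite (le_trans _ kK).
have B0 : 0 <= B by rewrite (le_trans _ bB).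
have N0 : r ^+ 2 / 2 <= r ^+ 2 + k.
  by move: kK; rewrite ler_norml /K => /andP[kK _]; lra.
have N1 : 0 < r ^+ 2 + k by lra.
have db : 0 < r ^+ 2 - b by lra.
split; first by rewrite divr_gt0// mulr_gt0.
have rn0 : r != 0 by rewrite gt_eqF.
have -> : r ^+ 2 - r / ((r ^+ 2 + k) / (r * (r ^+ 2 - b))) =
          (k + b) - (k + b) * k / (r ^+ 2 + k).
  by field; rewrite (gt_eqF N1) (gt_eqF db) rn0.
have -> : k + b - (k + b) * k / (r ^+ 2 + k) - (b + dot s v - enorm v ^+ 2 / 2)
  = ((sc - 1) * dot s v - (co - enorm v ^+ 2 / 2)) - (k + b) * k / (r ^+ 2 + k).
  by rewrite /k; ring.
set z := (r ^+ 2)^-1 in s1 c1 *; have z0 : 0 < z by rewrite invr_gt0.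
have t1 : `|(sc - 1) * dot s v| <= (L ^+ 2 / 2 * z) * (S * L).
  by rewrite normrM ler_pM// ler_norml; apply/andP; split; lra.
have t2 : `|co - enorm v ^+ 2 / 2| <= L ^+ 4 / 8 * z.
  have : 0 <= L ^+ 4 / 8 * z by rewrite mulr_ge0 ?(ltW z0)// divr_ge0// exprn_ge0.
  by rewrite ler_norml => ?; apply/andP; split; lra.
have t3 : `|(k + b) * k / (r ^+ 2 + k)| <= (K + B) * K * (2 * z).
  have i0 : 0 < (r ^+ 2 + k)^-1 by rewrite invr_gt0.
  have i1 : (r ^+ 2 + k)^-1 <= 2 * z.
    rewrite -(ler_pM2l N1) divff ?(gt_eqF N1)//.
    have rz : r ^+ 2 * z = 1 by rewrite divff// gt_eqF.
    by nra.
  rewrite !normrM (gtr0_norm i0) ler_pM ?mulr_ge0 ?(ltW i0)//.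
  by rewrite ler_pM// (le_trans (ler_normD _ _))// lerD.
apply: (le_trans (ler_normB _ _)); have := ler_normB ((sc - 1) * dot s v) (co - enorm v ^+ 2 / 2).
by rewrite /C -/z => t4; lra.
Qed.

Lemma hull_height_ge c (r : R) X v a : 0 < c -> sign_covered c X -> 0 < r ->
  polar X a -> 0 < dot a (exp_map (r^-1 *: v)) ->
  r ^+ 2 - r / dot a (exp_map (r^-1 *: v)) <= hull_height r X v.
Proof.
move=> c0 cov r0 Xa au; rewrite lerB// ler_pM2l// lef_pV2 ?posrE//.
  exact: (gauge_ge c0 cov).
by apply: lt_le_trans au _; exact: (gauge_ge c0 cov).
Qed.

Lemma hull_height_le c (r t : R) X v : 0 < c -> sign_covered c X -> 0 < r ->
  t < r ^+ 2 -> 0 < gauge X (exp_map (r^-1 *: v)) ->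
  (forall a, polar X a -> dot a (exp_map (r^-1 *: v)) <= r / (r ^+ 2 - t)) ->
  hull_height r X v <= t.
Proof.
move=> c0 cov r0 tr g0 H; rewrite /hull_height lerBlDl -lerBlDr.
have {H}gt := gauge_le H.
have d0 : 0 < r ^+ 2 - t by rewrite subr_gt0.
rewrite ler_pdivlMr// mulrC -ler_pdivlMr//.
Qed.

End minorants.

(** * Hulls of empty paraboloids *)

Definition admissible (R : realType) n (Z : set ('rV[R]_n * R)) (S : R) :
  set (R * 'rV[R]_n) := [set l | minorant Z l.1 l.2 /\ norm1 l.2 <= S].

(** The lower convex envelope, with the slopes truncated at [S] in order to be
    finite and Lipschitz everywhere; over the window the truncation has no effect
    ([envelope_hull]). *)
Definition envelope (R : realType) n (Z : set ('rV[R]_n * R)) (S : R)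
    (v : 'rV[R]_n) : R :=
  sup [set l.1 + dot l.2 v | l in admissible Z S].

Section paraboloid_hulls.
Context {R : realType}.
Variable n : nat.
Implicit Types (v s : 'rV[R]_n) (p w : 'rV[R]_n * R) (Y Z : set ('rV[R]_n * R)).

Lemma downward_paraboloid_atE w p :
  downward_paraboloid_at w p <-> p.2 <= w.2 - enorm (p.1 - w.1) ^+ 2 / 2.
Proof.
case: w p => w1 w2 [p1 p2]; split=> [[[z1 z2] hz [<- <-]]|h].
  have -> : enorm ((w1 + z1, w2 + z2).1 - (w1, w2).1) = enorm z1.
    by rewrite /= (addrC w1) addrK.
  by move: hz; rewrite /downward_paraboloid/=; lra.
exists (p1 - w1, p2 - w2); last by congr pair; rewrite /= addrC subrK.
by move: h; rewrite /downward_paraboloid/=; lra.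
Qed.

Lemma nbhs_vertical (A : set ('rV[R]_n * R)) p : nbhs p A ->
  exists2 e, 0 < e & forall t, `|t - p.2| < e -> A (p.1, t).
Proof.
case: p => v h [[B C] /= [vB]]; rewrite -nbhs_ballE => -[e /= e0 eC] BCA.
exists e => // t th; apply: BCA; split => /=; first exact: nbhs_singleton vB.
by apply: eC; rewrite -ball_normE /= distrC.
Qed.

Lemma open_subgraph (G : 'rV[R]_n -> R) : continuous G ->
  open [set p : 'rV[R]_n * R | p.2 < G p.1] /\
  open [set p : 'rV[R]_n * R | G p.1 < p.2].
Proof.
move=> cG.
have c : continuous (fun p : 'rV[R]_n * R => G p.1 - p.2).
  move=> p; apply: (@cvgB _ _ _ (nbhs (p : 'rV[R]_n * R))).
    apply: (@continuous_comp _ _ _ (fun q : 'rV[R]_n * R => q.1) G).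
      exact: cvg_fst.
    exact: cG.
  exact: cvg_snd.
split.
  rewrite (_ : [set p | _] = (fun p : 'rV[R]_n * R => G p.1 - p.2) @^-1` [set t | 0 < t]).
    by apply: open_comp => //; exact: open_gt.
  by apply/seteqP; split => p /=; rewrite subr_gt0.
rewrite (_ : [set p | _] = (fun p : 'rV[R]_n * R => G p.1 - p.2) @^-1` [set t | t < 0]).
  by apply: open_comp => //; exact: open_lt.
by apply/seteqP; split => p /=; rewrite subr_lt0.
Qed.

Lemma continuous_sqr_enorm_sub u : continuous (fun v => enorm (v - u) ^+ 2).
Proof.
move=> v; apply: (@continuous_comp _ _ _ (fun v : 'rV[R]_n => v - u)
  (fun v => enorm v ^+ 2)); last exact: continuous_sqr_enorm.
by apply: (@cvgB _ _ _ (nbhs (v : 'rV[R]_n))); [exact: cvg_id|exact: cvg_cst].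
Qed.

Lemma interior_downward_paraboloid w p :
  (downward_paraboloid_at w)° p <-> p.2 < w.2 - enorm (p.1 - w.1) ^+ 2 / 2.
Proof.
split=> [/nbhs_vertical[e e0 h]|h].
  have : downward_paraboloid_at w (p.1, p.2 + e / 2).
    apply: h; rewrite addrAC subrr add0r gtr0_norm ?divr_gt0//.
    by rewrite ltr_pdivrMr//; lra.
  by move/downward_paraboloid_atE => /=; lra.
have [|o _] := @open_subgraph (fun v => w.2 - enorm (v - w.1) ^+ 2 / 2).
  move=> v; apply: (@cvgB _ _ _ (nbhs (v : 'rV[R]_n))); first exact: cvg_cst.
  apply: (@cvgMr_tmp _ _ (nbhs (v : 'rV[R]_n))); exact: continuous_sqr_enorm_sub.
apply: filterS (open_nbhs_nbhs (conj o h)) => q hq.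
by apply/downward_paraboloid_atE; exact: ltW.
Qed.

Lemma dot_enorm_sub v s :
  enorm (v - s) ^+ 2 = enorm v ^+ 2 - 2 * dot s v + enorm s ^+ 2.
Proof. by rewrite !sqr_enorm dotBl !dotBr (dotC v s); ring. Qed.

(** Expanding the square, the paraboloid with apex (w1, w2) is unbent to the
    half-space below the affine function of slope w1. *)
Lemma empty_paraboloidP Y w :
  Y `&` (downward_paraboloid_at w)° = set0 <->
  minorant (@unbend R n @` Y) (w.2 - enorm w.1 ^+ 2 / 2) w.1.
Proof.
split=> [Y0 _ [p Yp <-] /=|Yw].
  rewrite leNgt; apply/negP => h.
  suff : (Y `&` (downward_paraboloid_at w)°) p by rewrite Y0.
  by split => //; apply/interior_downward_paraboloid; rewrite dot_enorm_sub; lra.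
rewrite -subset0 => p [Yp /interior_downward_paraboloid]; rewrite dot_enorm_sub.
by have /= := Yw _ (imageP _ Yp); lra.
Qed.

Lemma paraboloid_hullP Y p :
  paraboloid_hull Y p <->
  exists b s, minorant (@unbend R n @` Y) b s /\ (unbend p).2 <= b + dot s p.1.
Proof.
split=> [[w /= /empty_paraboloidP Yw /downward_paraboloid_atE h]|[b [s [Ys h]]]].
  exists (w.2 - enorm w.1 ^+ 2 / 2), w.1; split => //=.
  by move: h; rewrite dot_enorm_sub; lra.
exists (s, b + enorm s ^+ 2 / 2).
  by apply/empty_paraboloidP => /=; rewrite addrK.
by apply/downward_paraboloid_atE; move: h => /=; rewrite dot_enorm_sub; lra.
Qed.

Section envelope.
Variables (Y : set ('rV[R]_n * R)) (A Q L S : R).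
Let Z := @unbend R n @` Y.
Hypotheses (L0 : 0 <= L) (A0 : 0 <= A) (Q0 : 0 <= Q) (SQA : 2 * (Q + A) <= S).
Hypothesis Zlow : minorant Z (- A) 0.
Hypothesis Zcov : sign_covered (L + 1) [set z.1 | z in Z `&` [set z | z.2 <= Q]].

Lemma admissible_slope b s : minorant Z b s -> b + (L + 1) * norm1 s <= Q.
Proof. by move=> Zb; apply: minorant_slope Zb Zcov; exact: addr_ge0. Qed.

Lemma admissible_low : admissible Z S (- A, 0).
Proof.
split => //=; rewrite /norm1 big1 => [|i _]; last by rewrite mxE normr0.
by have := A0; have := Q0; have := SQA; lra.
Qed.

Lemma envelope_ge v b s : minorant Z b s -> norm1 s <= S ->
  b + dot s v <= envelope Z S v.
Proof.
move=> Zb sS; apply: ub_le_sup; last by exists (b, s).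
exists (Q + S * enorm v) => _ [[b' s'] [/= /admissible_slope h s'S] <-].
have := ler_dot_enorm s' v; rewrite ler_norml => /andP[_ h'].
have := norm1_ge0 s'; have := enorm_ge0 v; have := L0; nra.
Qed.

Lemma envelope_le v t :
  (forall b s, minorant Z b s -> norm1 s <= S -> b + dot s v <= t) ->
  envelope Z S v <= t.
Proof.
move=> H; apply: ge_sup => [|_ [[b s] [/= Zb sS] <-]]; last exact: H.
by exists (- A + dot 0 v), (- A, 0) => //; exact: admissible_low.
Qed.

Lemma envelope_low v : - A <= envelope Z S v.
Proof. by have := envelope_ge v admissible_low.1 admissible_low.2; rewrite dot0l addr0. Qed.

Lemma envelope_high v : enorm v <= L -> envelope Z S v <= Q.
Proof.
move=> vL; apply: envelope_le => b s /admissible_slope h _.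
have := ler_dot_enorm s v; rewrite ler_norml => /andP[_ h'].
have := norm1_ge0 s; have := enorm_ge0 v; have := L0; nra.
Qed.

Lemma continuous_envelope : continuous (envelope Z S).
Proof.
move=> v; apply/(@cvgrPdist_le _ _ _ (nbhs (v : 'rV[R]_n))) => /= e e0.
have S0 : 0 < S + 1 by have := A0; have := Q0; have := SQA; lra.
have lip (x y : 'rV[R]_n) :
    envelope Z S y <= envelope Z S x + S * `|y - x|.
  apply: envelope_le => b s Zb sS.
  have -> : dot s y = dot s x + dot s (y - x) by rewrite -dotDr addrC subrK.
  rewrite addrA lerD ?envelope_ge//.
  apply: (@le_trans _ _ (norm1 s * `|y - x|)); last by rewrite ler_wpM2r.
  by apply: ler_dot => i; rewrite [leRHS]mx_normrE; apply: (le_bigmax _ _ (ord0, i)).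
have eS : 0 < e / (S + 1) by rewrite divr_gt0.
have := @nbhsx_ballx R 'rV[R]_n v _ eS; apply: filterS => w.
rewrite -ball_normE /= ltr_pdivlMr// => vw; rewrite ler_norml.
have := lip v w; have := lip w v; rewrite (distrC w v) => h1 h2.
have := normr_ge0 (v - w) => h3.
by apply/andP; split; nra.
Qed.

(** A minorant with a slope above [S] is below [- A] over the window, by
    [admissible_slope], and there the horizontal minorant [- A] does better. *)
Lemma envelope_hull p : (forall i, `|p.1 ord0 i| <= L + 1 / 2) ->
  (paraboloid_hull Y p -> (unbend p).2 <= envelope Z S p.1) /\
  ((unbend p).2 < envelope Z S p.1 -> paraboloid_hull Y p).
Proof.
move=> pL; split=> [/paraboloid_hullP[b [s [Zb h]]]|h].
  have [hA|hA] := lerP (unbend p).2 (- A); first exact: le_trans hA (envelope_low _).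
  apply: (le_trans h); apply: envelope_ge => //.
  have := admissible_slope Zb; have := ler_dot s pL; have := norm1_ge0 s.
  by have := A0; have := Q0; have := SQA; lra.
apply/paraboloid_hullP; apply: contrapT => nh.
move: h; rewrite ltNge => /negP; apply; apply: envelope_le => b s Zb sS.
by rewrite leNgt; apply/negP => h; apply: nh; exists b, s; split => //; exact: ltW.
Qed.

Definition paraboloid_height v := envelope Z S v - enorm v ^+ 2 / 2.

Lemma continuous_paraboloid_height : continuous paraboloid_height.
Proof.
move=> v; apply: (@cvgB _ _ _ (nbhs (v : 'rV[R]_n))).
  exact: continuous_envelope.
by apply: (@cvgMr_tmp _ _ (nbhs (v : 'rV[R]_n))); exact: continuous_sqr_enorm.
Qed.

Lemma boundary_paraboloid_hull p : (forall i, `|p.1 ord0 i| < L + 1 / 2) ->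
  boundary (paraboloid_hull Y) p <-> p.2 = paraboloid_height p.1.
Proof.
move=> pL.
pose N : set ('rV[R]_n * R) :=
  [set q : 'rV[R]_n * R | forall i, `|q.1 ord0 i| < L + 1 / 2].
have Np : nbhs p N.
  apply: (@filter_forall _ _ (fun i (q : 'rV[R]_n * R) => `|q.1 ord0 i| < L + 1 / 2)
    (nbhs p)) => i.
  have c : continuous (fun q : 'rV[R]_n * R => `|q.1 ord0 i|).
    move=> q; apply: (@continuous_comp _ _ _ (fun q : 'rV[R]_n * R => q.1)
      (fun v : 'rV[R]_n => `|v ord0 i|)); first exact: cvg_fst.
    apply: (@continuous_comp _ _ _ (fun v : 'rV[R]_n => v ord0 i) (fun t : R => `|t|)).
      exact: (@coord_continuous R 1 n ord0 i q.1).
    exact: norm_continuous.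
  apply: (@open_nbhs_nbhs _ p); split; last exact: pL.
  exact: (open_comp (fun q _ => c q) (@open_lt R (L + 1 / 2))).
have NH q : N q -> (paraboloid_hull Y q -> q.2 <= paraboloid_height q.1) /\
    (q.2 < paraboloid_height q.1 -> paraboloid_hull Y q).
  move=> Nq; have [|h1 h2] := @envelope_hull q; first by move=> i; exact: ltW.
  split; first by move=> /h1 /=; rewrite /paraboloid_height; lra.
  by move=> h; apply: h2 => /=; move: h; rewrite /paraboloid_height; lra.
have [ob oa] := open_subgraph continuous_paraboloid_height.
split=> [[cl ni]|pE].
  apply/eqP; rewrite eq_le; apply/andP; split; rewrite leNgt; apply/negP => h.
    have := cl _ (filterI Np (open_nbhs_nbhs (conj oa h))).
    by move=> [q [Yq [/NH[/(_ Yq) h1 _] /= h2]]]; move: h1; rewrite leNgt h2.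
  apply: ni; apply: filterS (filterI Np (open_nbhs_nbhs (conj ob h))).
  by move=> q [/NH[_ h1] /= h2]; exact: h1.
split.
  move=> B pB; have [e e0 eB] := nbhs_vertical (filterI Np pB).
  have [|NN BB] := eB (p.2 - e / 2).
    by rewrite addrAC subrr add0r normrN gtr0_norm ?divr_gt0// ltr_pdivrMr//; lra.
  by exists (p.1, p.2 - e / 2); split => //; apply: (NH _ NN).2 => /=; lra.
move=> pI; have [e e0 eB] := nbhs_vertical (filterI Np pI).
have [|NN YY] := eB (p.2 + e / 2).
  by rewrite addrAC subrr add0r gtr0_norm ?divr_gt0// ltr_pdivrMr//; lra.
by have /= := (NH _ NN).1 YY; lra.
Qed.

End envelope.
End paraboloid_hulls.

(** * Comparison of the two boundaries *)

Section comparison.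
Context {R : realType}.
Variable n : nat.
Implicit Types (v s : 'rV[R]_n) (X : set 'rV[R]_n.+1) (Y : set ('rV[R]_n * R)).

(** Along each ray the boundary has exactly one point, by homogeneity of the
    gauge, and a bound on [L] keeps the window away from the south pole. *)
Lemma hull_graph (c r L : R) X : (0 < n)%N -> 0 < r -> L < pi * r ->
  0 < c -> sign_covered c X ->
  (forall v, enorm v <= L -> 0 < gauge X (exp_map (r^-1 *: v))) ->
  continuous_graph_on (eball (n := n) L)
    (scaling_by r @` boundary (convex_hull X)) (hull_height r X).
Proof.
move=> n0 r0 Lpi c0 cov g0; rewrite (boundary_hull c0 cov); split.
  apply: continuous_in_subspaceT => v; rewrite inE => /g0 gv.
  apply: (@cvgB _ _ _ (nbhs (v : 'rV[R]_n))); first exact: cvg_cst.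
  apply: (@cvgMl_tmp _ _ (nbhs (v : 'rV[R]_n))).
  apply: (@cvgV _ _ (nbhs (v : 'rV[R]_n))); first by rewrite gt_eqF.
  apply: (@continuous_comp _ _ _ (fun v : 'rV[R]_n => exp_map (r^-1 *: v)) (gauge X)).
    apply: (@continuous_comp _ _ _ (fun v : 'rV[R]_n => r^-1 *: v) (@exp_map R n)).
      exact: scaler_continuous.
    exact: continuous_exp_map.
  exact: (continuous_gauge c0 cov).
have gE v : enorm v <= L -> forall rho, 0 <= rho ->
    (gauge X (rho *: exp_map (r^-1 *: v)) = 1 <-> rho = (gauge X (exp_map (r^-1 *: v)))^-1).
  move=> /g0 gv rho rho0; rewrite (gaugeZ c0 cov)//; split=> [h|->].
    by rewrite -[RHS]mul1r -h mulfK// gt_eqF.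
  by rewrite mulVf// gt_eqF.
apply/seteqP; split => [p [[x /= x1 <-] [vL _]]|_ [v vL <-]].
  have x0 : x != 0.
    apply: contra_eq_neq x1 => ->; rewrite -(scale0r 0) (gaugeZ c0 cov)// mul0r eq_sym.
    exact: oner_neq0.
  exists (scaling_by r x).1 => //.
  have hE := scaling_by_height r0 x0.
  have xE := scaling_by_polar n0 r0 x0; rewrite hE in xE.
  move: x1; rewrite {1}xE gE ?enorm_ge0// => nx.
  rewrite [RHS]surjective_pairing; congr pair.
  rewrite /hull_height -nx -hE; field; exact: lt0r_neq0.
split => //; exists ((gauge X (exp_map (r^-1 *: v)))^-1 *: exp_map (r^-1 *: v)).
  by apply/gE => //; rewrite invr_ge0 ltW// g0.
rewrite scaling_by_exp ?invr_gt0 ?g0//; last exact: le_lt_trans Lpi.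
congr pair; rewrite /hull_height; field.
by rewrite (lt0r_neq0 r0) (lt0r_neq0 (g0 _ vL)).
Qed.

Section close_sets.
Variables (X : set 'rV[R]_n.+1) (Y : set ('rV[R]_n * R)).
Variables (A Q L r d eps c : R).
(* [- A'] is a lower bound for the limit boundary over the window; [S] bounds the
   slopes and [B] the values at 0 of the minorants that are relevant there; [K]
   and [C] are the constants of [ray_height_close] for these bounds. *)
Let A' := A + L ^+ 2 / 2.
Let S := 2 * (Q + 1 + A').
Let K := S * L + L ^+ 2 / 2.
Let B := 2 * (Q + 1 + A' + S * L).
Let C := 2 * (K + B) * K + S * L * (L ^+ 2 / 2) + L ^+ 4 / 8.
Let ZX := flat r @` X.
Let ZY := @unbend R n @` Y.
Hypotheses (L0 : 0 < L) (A0 : 0 <= A) (Q0 : 0 <= Q) (e0 : 0 < eps).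
Hypotheses (r1 : 1 <= r) (rB : 2 * (K + B + eps) <= r ^+ 2)
  (rA : 4 * (L * A') <= r ^+ 2) (rC : C / r ^+ 2 <= eps / 2).
Hypotheses (d0 : 0 <= d) (d4 : d <= 1 / 4) (dS : d * (1 + S) <= eps / 4)
  (dS1 : d * (1 + S) <= 1).
Hypotheses (Lc : L + 1 <= c) (covX : sign_covered c X).
Hypothesis lowX : minorant ZX (- A) 0.
Hypothesis lowY : minorant ZY (- A) 0.
Hypothesis covY :
  sign_covered (L + 1) [set z.1 | z in ZY `&` [set z | z.2 <= Q]].

Hypotheses (XY : close_or_high (Q + 1) S d ZY ZX)
  (YX : close_or_high (Q + 1) S d ZX ZY).

Let r0 : 0 < r. Proof. exact: lt_le_trans r1. Qed.
Let c0 : 0 < c. Proof. by have := L0; have := Lc; lra. Qed.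
Let A'0 : 0 <= A'. Proof. by rewrite addr_ge0// divr_ge0// sqr_ge0. Qed.
Let S0 : 0 <= S. Proof. by have := A'0; have := Q0; rewrite /S; lra. Qed.
Let SL0 : 0 <= S * L. Proof. by rewrite mulr_ge0// ltW. Qed.
Let K0 : 0 <= K. Proof. by rewrite addr_ge0// divr_ge0// sqr_ge0. Qed.
Let B0 : 0 <= B.
Proof. by rewrite /B; have := A'0; have := Q0; have := SL0; lra. Qed.
Let SQA : 2 * (Q + A) <= S.
Proof.
have : A <= A' by rewrite lerDl divr_ge0// sqr_ge0.
by rewrite /S; lra.
Qed.
Let rK : 2 * K <= r ^+ 2.
Proof. by have := rB; have := B0; have := e0; lra. Qed.
Let Br : B < r ^+ 2.
Proof. by have := rB; have := B0; have := K0; have := e0; lra. Qed.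

(** The horizontal minorant [- A] yields an element of the polar that is positive
    in the directions of the window. *)
Lemma gauge_window_gt0 v : enorm v <= L -> 0 < gauge X (exp_map (r^-1 *: v)).
Proof.
move=> vL; have AB : `|- A| <= B.
  have : A <= A' by rewrite lerDl divr_ge0// sqr_ge0.
  by rewrite normrN ger0_norm// /B; have := Q0; have := SL0; have := A'0; lra.
have Ar : - A < r ^+ 2 by have := Br; have := B0; have := A0; lra.
have n0S : norm1 (0 : 'rV[R]_n) <= S.
  by rewrite /norm1 big1 => [|i _]; rewrite ?mxE ?normr0.
have [u0 _] := ray_height_close r1 (ltW L0) S0 vL n0S AB Ar rK.
apply: (lt_le_trans u0); apply: (gauge_ge c0 covX).
exact/polar_minorant.
Qed.

(** A minorant of the unbent limit points, shifted down a little, is a minorant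
    of the flattened points, hence an element of the polar. *)
Lemma hull_height_above v : enorm v <= L ->
  paraboloid_height Y S v - eps <= hull_height r X v.
Proof.
move=> vL; rewrite /paraboloid_height.
have H b s : minorant ZY b s -> norm1 s <= S -> - A <= b + dot s v ->
    b + dot s v <= hull_height r X v + enorm v ^+ 2 / 2 + eps.
  move=> Yb sS bA.
  have h := admissible_slope (ltW L0) covY Yb.
  have sn0 := norm1_ge0 s.
  have bQ : b <= Q by have := L0; nra.
  have svL : dot s v <= S * L.
    apply: (@le_trans _ _ (norm1 s * enorm v)).
      by have := ler_dot_enorm s v; rewrite ler_norml => /andP[].
    by rewrite ler_pM// enorm_ge0.
  have AA : A <= A' by rewrite lerDl divr_ge0// sqr_ge0.
  have bB : `|b - d * (1 + S)| <= B.
    have : 0 <= d * (1 + S) by rewrite mulr_ge0// addr_ge0.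
    rewrite ler_norml /B; have := dS1; have := Q0; have := SL0; have := A'0; move=> *.
    by apply/andP; split; lra.
  have br : b - d * (1 + S) < r ^+ 2.
    by move: bB; rewrite ler_norml => /andP[_ bB]; apply: le_lt_trans bB Br.
  have Xb : minorant ZX (b - d * (1 + S)) s.
    apply: (minorant_transfer d0 sS _ Yb XY); apply: (le_trans bQ).
    by rewrite lerDl.
  have [u0 hh] := ray_height_close r1 (ltW L0) S0 vL sS bB br rK.
  have Xp := (polar_minorant s X br).2 Xb.
  have := hull_height_ge c0 covX r0 Xp u0.
  move: (le_trans hh rC); rewrite ler_norml => /andP[h1 _] h2.
  by have := dS; have := e0; move=> *; lra.
suff : envelope ZY S v <= hull_height r X v + enorm v ^+ 2 / 2 + eps by lra.
apply: (envelope_le A0 Q0 SQA lowY) => b s Yb sS.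
have [bA|bA] := lerP (- A) (b + dot s v); first exact: H.
apply: le_trans (ltW bA) _.
have := H (- A) 0 lowY; rewrite dot0l addr0; apply=> //.
by rewrite /norm1 big1 => [|i _]; rewrite ?mxE ?normr0.
Qed.

Let near_cov :
  sign_covered (L + 1 - d) [set z.1 | z in ZX `&` [set z | z.2 <= Q + d]].
Proof.
move=> tau; have [_ [z [Yz /= zQ] <-] zt] := covY tau.
have [[z' Xz' [z1 z2]]|far] := YX Yz; last first.
  have : 0 <= S * enorm z.1 by rewrite mulr_ge0 ?enorm_ge0.
  by move: far zQ; lra.
move: z2; rewrite ler_norml => /andP[_ z2].
exists z'.1; first by exists z' => //; split => //=; lra.
move=> i; have := zt i; have := z1 i; rewrite ler_norml => /andP[h1 h2].
by case: (tau i); rewrite ?(expr0, expr1, mul1r, mulN1r) => h; lra.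
Qed.

(** A half-space that binds near the window is not steep: its boundary passes
    below the covering points and above a fixed height over the window. *)
Let steep_bound b s v (t : R) : enorm v <= L -> b < r ^+ 2 -> - A' <= t ->
  minorant ZX b s ->
  0 < dot (polar_point r b s) (exp_map (r^-1 *: v)) ->
  t < r ^+ 2 - r / dot (polar_point r b s) (exp_map (r^-1 *: v)) ->
  norm1 s <= S /\ `|b| <= B.
Proof.
move=> vL br tA Xb.
have Ld : 0 <= L + 1 - d by have := L0; have := d4; lra.
have bQ := minorant_slope Ld Xb near_cov.
have r2 : 0 < r ^+ 2 by rewrite exprn_gt0.
rewrite dot_polar_point_exp//.
have sc1 : `|sinc (enorm v / r)| <= 1 by apply: abs_sinc_le1; exact: angle_ge0.
have c3 : 0 <= r ^+ 2 * (1 - cos (enorm v / r)).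
  by rewrite mulr_ge0 ?sqr_ge0// subr_ge0 cos_le1.
set sc := sinc _ in sc1 *; set co := r ^+ 2 * (1 - _) in c3 *.
have sn0 := norm1_ge0 s.
have kL : sc * dot s v - co <= norm1 s * L.
  have : `|sc * dot s v| <= norm1 s * L.
    rewrite normrM -[leRHS]mul1r ler_pM// (le_trans (ler_dot_enorm _ _))//.
    by rewrite ler_wpM2l.
  by rewrite ler_norml => /andP[_]; lra.
set k := sc * dot s v - co in kL *.
have db : 0 < r ^+ 2 - b by rewrite subr_gt0.
have rdb : 0 < r * (r ^+ 2 - b) by rewrite mulr_gt0.
rewrite pmulr_lgt0 ?invr_gt0// => N0.
have -> : r ^+ 2 - r / ((r ^+ 2 + k) / (r * (r ^+ 2 - b))) =
          r ^+ 2 * (k + b) / (r ^+ 2 + k).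
  by field; rewrite (gt_eqF N0) (gt_eqF db) (gt_eqF r0).
rewrite ltr_pdivlMr// => tk.
have {tA tk}tk : - A' * (r ^+ 2 + k) < r ^+ 2 * (k + b).
  by apply: le_lt_trans tk; rewrite ler_wpM2r// ltW.
have sL0 : 0 <= norm1 s * L by rewrite mulr_ge0// ltW.
have rA' : A' * (norm1 s * L) <= norm1 s * (r ^+ 2 / 4).
  by rewrite mulrCA ler_wpM2l//; have := rA; lra.
have e1 : 0 < r ^+ 2 * (norm1 s * L + b + A') + A' * (norm1 s * L).
  have : A' * k <= A' * (norm1 s * L) by rewrite ler_wpM2l.
  have : r ^+ 2 * k <= r ^+ 2 * (norm1 s * L) by rewrite ler_wpM2l// ltW.
  by move: tk; lra.
have {e1 rA'}e2 : 0 < norm1 s * L + b + A' + norm1 s / 4.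
  by rewrite -(pmulr_rgt0 _ r2); lra.
have sd : norm1 s * d <= norm1 s * (1 / 4) by rewrite ler_wpM2l.
have sS : norm1 s <= S.
  by rewrite /S; have := A'0; have := Q0; have := d4; move=> *; lra.
split=> //; have sLS : norm1 s * L <= S * L by rewrite ler_wpM2r// ltW.
have sd' : d * norm1 s <= norm1 s by rewrite ler_piMl//; have := d4; lra.
have Lsn : 0 <= (L + 1 - d) * norm1 s by rewrite mulr_ge0.
have sA : norm1 s / 4 <= 1 + Q + A' + S * L.
  have : norm1 s / 4 <= S / 4 by rewrite ler_pM2r.
  by rewrite {1}/S; have := SL0; have := A'0; have := Q0; move=> *; lra.
by rewrite ler_norml /B; have := d4; have := A'0; have := SL0; have := Q0; move=> *;
  apply/andP; split; lra.
Qed.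

(** Conversely, an element of the polar that would make the hull too high in the
    direction [v] faces the north pole, since the cube in the hull bounds its
    other coordinates; it thus comes from a minorant, which is not steep and can
    be transferred to the limit points. *)
Lemma hull_height_below v : enorm v <= L ->
  hull_height r X v <= paraboloid_height Y S v + eps.
Proof.
move=> vL; set t := _ + eps.
have tA : - A' <= t.
  have := envelope_low (ltW L0) A0 Q0 SQA lowY covY v.
  rewrite /t /paraboloid_height /A'.
  have : enorm v ^+ 2 <= L ^+ 2 by apply: lerXn2r; rewrite ?nnegrE ?enorm_ge0// ltW.
  by have := e0; lra.
have tr : t < r ^+ 2.
  have := envelope_high (ltW L0) A0 Q0 SQA lowY covY vL.
  rewrite /t /paraboloid_height; have := sqr_ge0 (enorm v).
  have QB : Q <= B by rewrite /B; have := A'0; have := SL0; have := Q0; lra.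
  by have := rB; have := K0; have := B0; have := Br; have := e0; move=> *; lra.
apply: (hull_height_le c0 covX r0 tr (gauge_window_gt0 vL)) => a Xa.
have r2 : 0 < r ^+ 2 by rewrite exprn_gt0.
have dt : 0 < r ^+ 2 - t by rewrite subr_gt0.
rewrite leNgt; apply/negP => at_.
have au0 : 0 < dot a (exp_map (r^-1 *: v)) by apply: lt_trans at_; rewrite divr_gt0.
(* The horizontal part of the pairing is at most L / (c r), and c > L. *)
have al0 : 0 < rv_last a.
  move: at_; rewrite dot_split rv_last_exp_map rv_head_exp_map enorm_angle// => at_.
  have cos1 := cos_le1 (enorm v / r).
  have cos0 : 0 <= cos (enorm v / r).
    have := cos_ge (angle_ge0 v r0).
    have : (enorm v / r) ^+ 2 <= 1.
      rewrite expr_div_n ler_pdivrMr// mul1r.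
      have : enorm v ^+ 2 <= L ^+ 2 by apply: lerXn2r; rewrite ?nnegrE ?enorm_ge0// ltW.
      by have := rK; have := SL0; rewrite /K; lra.
    by lra.
  rewrite ltNge; apply/negP => al0.
  have : rv_last a * cos (enorm v / r) <= 0 by rewrite mulr_le0_ge0.
  have a1 := polar_norm1 c0 covX Xa; rewrite norm1_split in a1.
  have : dot (rv_head a) (sinc (enorm v / r) *: (r^-1 *: v)) <= c^-1 * (L / r).
    apply: le_trans (ler_norm _) _; apply: le_trans (ler_dot_enorm _ _) _.
    rewrite ler_pM ?norm1_ge0 ?enorm_ge0//.
      by have := normr_ge0 (rv_last a); lra.
    rewrite enormZ enorm_angle// -[leRHS]mul1r ler_pM ?angle_ge0//.
      by apply: abs_sinc_le1; exact: angle_ge0.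
    by rewrite ler_pM2r// invr_gt0.
  have : c^-1 * (L / r) <= r / (r ^+ 2 - t).
    have -> : c^-1 * (L / r) = L / (c * r) by rewrite invfM; ring.
    rewrite ler_pdivrMr ?mulr_gt0// mulrAC ler_pdivlMr// mulrCA -expr2.
    have Lc2 : (L + 1) * r ^+ 2 <= c * r ^+ 2 by rewrite ler_wpM2r// ltW.
    have LA : L * (- t) <= L * A' by rewrite ler_wpM2l ?(ltW L0)//; lra.
    have := rA; have := mulr_ge0 (ltW L0) A'0; lra.
  by lra.
have [b [s [br aE]]] := polar_pointP r0 al0; rewrite {}aE in Xa au0 at_.
have Xb := (polar_minorant s X br).1 Xa.
have at' : t < r ^+ 2 - r / dot (polar_point r b s) (exp_map (r^-1 *: v)).
  rewrite ltrBrDr -ltrBrDl ltr_pdivrMr//.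
  by rewrite mulrC -ltr_pdivrMr.
have [sS bB] := steep_bound vL br tA Xb au0 at'.
have [_ hh] := ray_height_close r1 (ltW L0) S0 vL sS bB br rK.
have bQ : b <= Q + 1.
  have Ld : 0 <= L + 1 - d by have := L0; have := d4; lra.
  have := minorant_slope Ld Xb near_cov.
  have : 0 <= (L + 1 - d) * norm1 s by rewrite mulr_ge0 ?norm1_ge0.
  by have := d4; lra.
have Yb := minorant_transfer d0 sS bQ Xb YX.
have := envelope_ge (ltW L0) covY v Yb sS.
move: (le_trans hh rC); rewrite ler_norml => /andP[_ h1].
by move: at'; rewrite /t /paraboloid_height; have := dS; have := e0; move=> *; lra.
Qed.

End close_sets.
End comparison.

(** * Localization *)

Definition window (R : realType) n (M H : R) : set ('rV[R]_n * R) :=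
  [set p | enorm p.1 <= M /\ `|p.2| <= H].

Arguments window {R n} M H.

Section localization.
Context {R : realType}.
Variable n : nat.
Implicit Types (v s : 'rV[R]_n) (X : set 'rV[R]_n.+1) (Y : set ('rV[R]_n * R)).

Lemma quadratic_beats_affine (S a t : R) : 0 <= S -> 0 <= a ->
  4 * (S + a + 1) <= t -> a + S * t <= t ^+ 2 / 4.
Proof. by move=> S0 a0 h; nra. Qed.

(** All the points are above a parabola; those that are not high are therefore
    at horizontal distance at most M1, hence at height at most Q2.  They are
    then in the window, where the two sets correspond to each other through the
    scaling transform. *)
Lemma close_or_high_localized (A Q S M H r d : R) X Y :
  (0 < n)%N -> 0 <= A -> 0 <= Q -> 0 <= S -> 1 <= r ->
  let M1 := 4 * (S + (Q + 1 + A) + 1) in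
  let Q2 := Q + 1 + S * M1 in
  2 * M1 <= M -> Q2 + A + M1 ^+ 2 <= H -> H < r ^+ 2 -> 2 * Q2 <= r ^+ 2 ->
  ((M ^+ 2 / 2 + H) * M + M ^+ 4 / 8 + H * M ^+ 2) / r ^+ 2 <= d ->
  (forall p, Y p -> - A + enorm p.1 ^+ 2 / 4 <= (unbend p).2) ->
  (forall x, X x -> - A + enorm (rv_head x) ^+ 2 / 4 <= (flat r x).2) ->
  (scaling_by r @` X) `&` window M H = Y `&` window M H ->
  close_or_high (Q + 1) S d (@unbend R n @` Y) (flat r @` X) /\
  close_or_high (Q + 1) S d (flat r @` X) (@unbend R n @` Y).
Proof.
move=> n0 A0 Q0 S0 r1 M1 Q2 MM HH Hr Qr Cd lowY lowX XY.
have r0 : 0 < r by rewrite (lt_le_trans ltr01).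
have M10 : 0 <= M1 by rewrite /M1; lra.
have Q20 : 0 <= Q2 by rewrite /Q2; have := mulr_ge0 S0 M10; lra.
have M0 : 0 <= M by lra.
have M12 := sqr_ge0 M1; have H0 : 0 <= H by lra.
have far (z : 'rV[R]_n * R) : - A + enorm z.1 ^+ 2 / 4 <= z.2 ->
    ~ (Q + 1 + S * enorm z.1 <= z.2) ->
    enorm z.1 <= M1 /\ - A <= z.2 <= Q2.
  move=> zl /negP; rewrite -ltNge => zh.
  have zM : enorm z.1 <= M1.
    rewrite leNgt; apply/negP => /ltW /(quadratic_beats_affine S0 _).
    have -> : 0 <= Q + 1 + A by lra.
    by move=> /(_ isT); lra.
  split=> //; apply/andP; split; first by have := sqr_ge0 (enorm z.1); lra.
  by rewrite /Q2; have := ler_wpM2l S0 zM; lra.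
have clo (x : 'rV[R]_n.+1) : x != 0 -> window M H (scaling_by r x) ->
    (forall i, `|(flat r x).1 ord0 i - (unbend (scaling_by r x)).1 ord0 i| <= d) /\
    `|(flat r x).2 - (unbend (scaling_by r x)).2| <= d.
  move=> x0 [xM xH]; have [h1 h2] := flat_close n0 r1 M0 H0 x0 xM xH.
  by split=> [i|]; [exact: le_trans (h1 i) Cd|exact: le_trans h2 Cd].
split=> _ [z Zz <-].
  have [|nh] := pselect (Q + 1 + S * enorm (flat r z).1 <= (flat r z).2); first by right.
  left; have [zM zQ] := far (flat r z) (lowX _ Zz) nh.
  have [z0 vM /andP[h1 h2]] := flat_window n0 r0 Qr zM zQ.
  have Wz : window M H (scaling_by r z).
    split; first exact: le_trans MM.
    by rewrite ler_norml; apply/andP; split; clear -h1 h2 HH A0 M12 Q20; lra.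
  have : (Y `&` window M H) (scaling_by r z).
    by rewrite -XY; split => //; exists z.
  move=> [Yz _]; exists (unbend (scaling_by r z)); first by exists (scaling_by r z).
  have [k1 k2] := clo _ z0 Wz.
  by split=> [i|]; rewrite distrC.
have [|nh] := pselect (Q + 1 + S * enorm (unbend z).1 <= (unbend z).2); first by right.
left; have [zM /andP[zA zQ]] := far (unbend z) (lowY _ Zz) nh.
have Wz : window M H z.
  rewrite /= in zM zA zQ; have : enorm z.1 ^+ 2 <= M1 ^+ 2.
    by apply: lerXn2r; rewrite ?nnegrE ?enorm_ge0.
  have := sqr_ge0 (enorm z.1) => h1 h2.
  split; first by clear -zM MM M10; lra.
  by rewrite ler_norml; apply/andP; split; clear -zA zQ HH A0 h1 h2 M12 Q20; lra.
have : ((scaling_by r @` X) `&` window M H) z by rewrite XY.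
move=> [[x Xx xz] _]; exists (flat r x); first by exists x.
rewrite -xz in Wz *; apply: clo => //.
apply: contraPneq Wz => -> [_ /=].
by rewrite /scaling_by eqxx/= ger0_norm ?sqr_ge0// leNgt Hr.
Qed.

(** A point in each of these boxes keeps the paraboloid hull, and the Gaussian
    one, below a fixed height over the window. *)
Definition lower_box (L H0 : R) (sigma : 'I_n -> bool) : set ('rV[R]_n * R) :=
  [set p : 'rV[R]_n * R | (forall i, L + 1 <= (-1) ^+ sigma i * p.1 ord0 i <= L + 2) /\
           0 <= p.2 <= H0].

Lemma lower_box_norm (L H0 : R) sigma p : 0 <= L -> lower_box L H0 sigma p ->
  enorm p.1 ^+ 2 <= n%:R * (L + 2) ^+ 2.
Proof.
move=> L0 [pb _]; rewrite sqr_enorm /dot.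
rewrite (le_trans (y := \sum_(i < n) (L + 2) ^+ 2))//; last first.
  by rewrite sumr_const card_ord mulr_natl.
apply: ler_sum => i _; have /andP[] := pb i.
by case: (sigma i); rewrite ?(expr0, expr1, mul1r, mulN1r) => ? ?; nra.
Qed.

Lemma minorant_low (Z : set ('rV[R]_n * R)) (A : R) :
  (forall z, Z z -> - A + enorm z.1 ^+ 2 / 4 <= z.2) -> minorant Z (- A) 0.
Proof.
by move=> low z /low; rewrite dot0l addr0; have := sqr_ge0 (enorm z.1); lra.
Qed.

Lemma summands_le (a b c d e f g r : R) : 0 <= a -> 0 <= b -> 0 <= c -> 0 <= d ->
  0 <= e -> 0 <= f -> 0 <= g -> 1 + a + b + c + d + e + f + g <= r ->
  [/\ 1 <= r, a <= r, b <= r & c <= r] /\ [/\ d <= r, e <= r, f < r & g <= r].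
Proof. by move=> *; split; split; lra. Qed.

(** The window and the threshold on the radius depend on the processes only
    through [A] and [H0]. *)
Theorem hull_boundary_close (L A H0 eps : R) :
  (0 < n)%N -> 0 < L -> 0 <= A -> 0 <= H0 -> 0 < eps ->
  exists M H r1, forall r, r1 <= r -> forall X Y,
    (forall p, Y p -> - A + enorm p.1 ^+ 2 / 4 <= (unbend p).2) ->
    (forall x, X x -> - A + enorm (rv_head x) ^+ 2 / 4 <= (flat r x).2) ->
    (scaling_by r @` X) `&` window M H = Y `&` window M H ->
    (forall sigma, Y `&` lower_box L H0 sigma !=set0) ->
    sign_covered (L + 1) X ->
    exists f g : 'rV[R]_n -> R,
      [/\ continuous_graph_on (eball (n := n) L)
            (scaling_by r @` boundary (convex_hull X)) f,
          continuous_graph_on (eball (n := n) L) (boundary (paraboloid_hull Y)) g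
        & (sup_dist (eball (n := n) L) f g <= eps%:E)%E].
Proof.
move=> n0 L0 A0 H00 e0.
have inL (v : 'rV[R]_n) : enorm v <= L -> forall i, `|v ord0 i| < L + 1 / 2.
  by move=> vL i; have := abs_coord_le v i; lra.
(* The unbent points of the boxes have a height at most Q. *)
pose Q := H0 + n%:R * (L + 2) ^+ 2 / 2.
pose A' := A + L ^+ 2 / 2.
pose S := 2 * (Q + 1 + A').
pose K := S * L + L ^+ 2 / 2.
pose B := 2 * (Q + 1 + A' + S * L).
pose C := 2 * (K + B) * K + S * L * (L ^+ 2 / 2) + L ^+ 4 / 8.
pose d := Num.min (1 / 4) (Num.min (eps / 4) 1 / (1 + S)).
pose M1 := 4 * (S + (Q + 1 + A) + 1).
pose Q2 := Q + 1 + S * M1.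
pose M := 2 * M1; pose H := Q2 + A + M1 ^+ 2.
pose C2 := (M ^+ 2 / 2 + H) * M + M ^+ 4 / 8 + H * M ^+ 2.
have n00 : 0 <= n%:R :> R by [].
have Q0 : 0 <= Q by rewrite addr_ge0// divr_ge0// mulr_ge0// sqr_ge0.
have A'0 : 0 <= A' by rewrite addr_ge0// divr_ge0// sqr_ge0.
have S0 : 0 <= S by rewrite /S; lra.
have SQA : 2 * (Q + A) <= S.
  have : A <= A' by rewrite lerDl divr_ge0// sqr_ge0.
  by rewrite /S => h; clear -h; lra.
have SL0 : 0 <= S * L by rewrite mulr_ge0// ltW.
have K0 : 0 <= K by rewrite addr_ge0// divr_ge0// sqr_ge0.
have B0 : 0 <= B by rewrite /B; lra.
have C0 : 0 <= C.
  have h1 : 0 <= (K + B) * K by rewrite mulr_ge0// addr_ge0.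
  have h2 : 0 <= S * L * (L ^+ 2 / 2) by rewrite mulr_ge0// divr_ge0// sqr_ge0.
  have h3 : 0 <= L ^+ 4 by rewrite exprn_ge0// ltW.
  by rewrite /C; lra.
have M10 : 0 <= M1 by rewrite /M1; lra.
have Q20 : 0 <= Q2 by have := mulr_ge0 S0 M10; rewrite /Q2; lra.
have M0 : 0 <= M by rewrite /M; lra.
have H'0 : 0 <= H by have := sqr_ge0 M1; rewrite /H; lra.
have C20 : 0 <= C2.
  have h1 : 0 <= (M ^+ 2 / 2 + H) * M by rewrite mulr_ge0// addr_ge0// divr_ge0// sqr_ge0.
  have h2 : 0 <= H * M ^+ 2 by rewrite mulr_ge0// sqr_ge0.
  have h3 : 0 <= M ^+ 4 by rewrite exprn_ge0.
  by rewrite /C2; lra.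
have S1 : 0 < 1 + S by rewrite ltr_pwDl.
have d0 : 0 < d.
  by rewrite lt_min divr_gt0//= divr_gt0// lt_min ltr01 divr_gt0.
have d4 : d <= 1 / 4 by rewrite ge_min lexx.
have dm : d * (1 + S) <= Num.min (eps / 4) 1.
  by rewrite -ler_pdivlMr// ge_min lexx orbT.
have dS : d * (1 + S) <= eps / 4 by rewrite (le_trans dm)// ge_min lexx.
have dS1 : d * (1 + S) <= 1 by rewrite (le_trans dm)// ge_min lexx orbT.
have LA0 : 0 <= L * A' by rewrite mulr_ge0// ltW.
have Ce0 : 0 <= C / (eps / 2) by rewrite divr_ge0// divr_ge0// ltW.
have Cd0 : 0 <= C2 / d by rewrite divr_ge0// ltW.
exists M, H, (1 + 2 * (K + B + eps) + 4 * (L * A') + C / (eps / 2) + C2 / d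
              + 2 * Q2 + H + L).
move=> r rr X Y lowY lowX XY boxY covX.
have a0 : 0 <= 2 * (K + B + eps) by rewrite mulr_ge0// addr_ge0 ?(ltW e0)// addr_ge0.
have b0 : 0 <= 4 * (L * A') by rewrite mulr_ge0.
have q0 : 0 <= 2 * Q2 by rewrite mulr_ge0.
have [[r1 ra rb rc] [rd re rf Lr]] :=
  summands_le a0 b0 Ce0 Cd0 q0 H'0 (ltW L0) rr.
have r0 : 0 < r by rewrite (lt_le_trans ltr01).
have r2 : r <= r ^+ 2 by rewrite expr2 ler_peMr// ltW.
have rr0 : 0 < r ^+ 2 by rewrite exprn_gt0.
have rC : C / r ^+ 2 <= eps / 2.
  by rewrite ler_pdivrMr// mulrC -ler_pdivrMr ?divr_gt0// (le_trans rc).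
have rC2 : C2 / r ^+ 2 <= d.
  by rewrite ler_pdivrMr// mulrC -ler_pdivrMr// (le_trans rd).
have rB := le_trans ra r2.
have rA := le_trans rb r2.
have Hr := lt_le_trans rf r2.
have Qr := le_trans re r2.
have [h1 h2] := close_or_high_localized n0 A0 Q0 S0 r1 (lexx M) (lexx H) Hr Qr rC2
  lowY lowX XY.
have lX : minorant (flat r @` X) (- A) 0.
  by apply: minorant_low => _ [x Xx <-]; exact: lowX.
have lY : minorant (@unbend R n @` Y) (- A) 0.
  by apply: minorant_low => _ [p Yp <-]; exact: (lowY p Yp).
have covY : sign_covered (L + 1)
    [set z.1 | z in (@unbend R n @` Y) `&` [set z | z.2 <= Q]].
  move=> sigma; have [p [Yp pbox]] := boxY sigma; have [pb /andP[p0 pH]] := pbox.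
  exists p.1; last by move=> i; case/andP: (pb i).
  exists (unbend p) => //; split; first by exists p.
  rewrite /= /Q lerD// ler_pM2r ?invr_gt0//.
  exact: lower_box_norm (ltW L0) pbox.
exists (hull_height r X), (paraboloid_height Y S); split.
- apply: (@hull_graph _ _ (L + 1)) => //.
  + by apply: (le_lt_trans Lr); rewrite ltr_pMl// (lt_le_trans _ (@pi_ge2 R))// ltr1n.
  + exact: addr_gt0.
  + move=> v vL; exact: (gauge_window_gt0 L0 A0 Q0 e0 r1 rB (lexx (L + 1)) covX lX vL).
- split.
    by apply: continuous_subspaceT; exact: (continuous_paraboloid_height (ltW L0) A0 Q0 SQA lY covY).
  have bh := boundary_paraboloid_hull (ltW L0) A0 Q0 SQA lY covY.
  apply/seteqP; split => [p [bp [pL _]]|_ [v vL <-]].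
    exists p.1 => //; rewrite [RHS]surjective_pairing; congr pair.
    by apply/esym/bh => //; exact: inL.
  by split=> //; apply/bh => //; exact: inL.
apply: ge_ereal_sup => _ [v vL <-]; rewrite lee_fin.
have a := hull_height_above L0 A0 Q0 e0 r1 rB rC (ltW d0) dS dS1 (lexx (L + 1)) covX
  lY covY h1 vL.
have b := hull_height_below L0 A0 Q0 e0 r1 rB rA rC (ltW d0) d4 dS (lexx (L + 1)) covX
  lX lY covY h2 vL.
by rewrite ler_distl a b.
Qed.

End localization.

(** * Void probabilities and outer measure *)

Section void_probabilities.
Context {R : realType} {d d' : measure_display} {Omega : measurableType d}
  {T : measurableType d'}.
Variables (P : probability Omega R) (X : Omega -> set T)
  (Lambda : set T -> \bar R).
Hypothesis ppp : poisson_point_process P X Lambda.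

Lemma point_count_eq0 (B : set T) omega :
  (point_count (R := R) X B omega == 0%E) = (X omega `&` B == set0 :> set T).
Proof.
rewrite /point_count /counting; case: asboolP => [fin|inf].
  rewrite eqe pnatr_eq0; apply/eqP/eqP => [/finmap.cardfs0_eq|->].
    exact: fset_set_set0.
  by rewrite fset_set0 finmap.cardfs0.
apply/esym/negbTE/eqP => E; apply: inf; rewrite E; exact: finite_set0.
Qed.

Lemma void_event (B : set T) :
  [set omega | X omega `&` B = set0] =
  [set omega | point_count X B omega = 0%:R%:E :> \bar R].
Proof.
apply/seteqP; split => omega /= h; apply/eqP.
  by rewrite point_count_eq0 h.
by rewrite -point_count_eq0 h.
Qed.

Lemma measurable_void (B : set T) : measurable B ->
  measurable [set omega | X omega `&` B = set0].
Proof.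
move=> mB; have [mc _ _ _] := ppp; rewrite void_event.
rewrite -[X in measurable X]setTI.
exact: (mc B mB measurableT [set 0%:E] (emeasurable_set1 _)).
Qed.

Lemma void_probability (B : set T) : measurable B -> (0 <= Lambda B)%E ->
  (Lambda B < +oo)%E ->
  P [set omega | X omega `&` B = set0] = (expR (- fine (Lambda B)))%:E.
Proof.
move=> mB L0 Loo; have [_ hp _ _] := ppp; rewrite void_event hp//.
rewrite /poisson_prob; case: ltP => h.
  by rewrite esum_set1 ?lee_fin ?poisson_pmf_ge0// /poisson_pmf h expr0 fact0 divr1 mul1r.
have -> : fine (Lambda B) = 0 by apply/eqP; rewrite eq_le h fine_ge0.
by rewrite oppr0 expR0 diracE mem_set.
Qed.

(** When the intensity is infinite, there are almost surely infinitely many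
    points, so that the bound holds as well. *)
Lemma void_probability_le (B : set T) (r : R) : measurable B ->
  (r%:E <= Lambda B)%E -> 0 <= r ->
  (mu_ext P [set omega | X omega `&` B = set0] <= (expR (- r))%:E)%E.
Proof.
move=> mB rL r0; have -> : mu_ext P [set omega | X omega `&` B = set0] =
    P [set omega | X omega `&` B = set0].
  by apply: measurable_mu_extE; exact: measurable_void.
have L0 : (0 <= Lambda B)%E by rewrite (le_trans _ rL)// lee_fin.
have [Loo|] := ltP (Lambda B) +oo%E.
  rewrite void_probability// lee_fin ler_expR lerN2 -lee_fin fineK//.
  by rewrite ge0_fin_numE.
rewrite leye_eq => /eqP Loo; have [mc _ hoo _] := ppp.
have h1 := hoo _ mB Loo.
have m1 : measurable [set omega | point_count X B omega = +oo%E :> \bar R].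
  rewrite -[X in measurable X]setTI.
  exact: (mc B mB measurableT [set +oo%E] (emeasurable_set1 _)).
apply: (@le_trans _ _ (P (~` [set omega | point_count X B omega = +oo%E :> \bar R]))).
  have mv := measurable_void mB.
  apply: le_measure; [exact/mem_set|exact/mem_set/measurableC|].
  by rewrite void_event => omega /= ->.
by rewrite probability_setC// h1 subee// lee_fin expR_ge0.
Qed.

Lemma hit_probability_le (B : set T) (e : R) : measurable B ->
  (0 <= Lambda B)%E -> (Lambda B <= e%:E)%E ->
  (mu_ext P [set omega | X omega `&` B != set0] <= e%:E)%E.
Proof.
move=> mB L0 Le; have Loo : (Lambda B < +oo)%E by rewrite (le_lt_trans Le)// ltry.
have -> : [set omega | X omega `&` B != set0] = ~` [set omega | X omega `&` B = set0].
  by apply/seteqP; split => omega /= /eqP.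
have -> : mu_ext P (~` [set omega | X omega `&` B = set0]) =
    P (~` [set omega | X omega `&` B = set0]).
  by apply: measurable_mu_extE; apply: measurableC; exact: measurable_void.
rewrite probability_setC; last exact: measurable_void.
rewrite void_probability// -EFinB lee_fin.
have := expR_ge1Dx (- fine (Lambda B)).
have : fine (Lambda B) <= e by rewrite -lee_fin fineK// ge0_fin_numE.
by lra.
Qed.

End void_probabilities.

Section outer_probability.
Context {R : realType} {d : measure_display} {Omega : measurableType d}.
Variable P : probability Omega R.

Lemma mu_extU (A B : set Omega) :
  (mu_ext P (A `|` B) <= mu_ext P A + mu_ext P B)%E.
Proof. exact: (outer_measureU2 (mu_ext P)). Qed.

Lemma mu_ext_finU (I : finType) (A : I -> set Omega) (e : R) :
  (forall i, (mu_ext P (A i) <= e%:E)%E) ->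
  (mu_ext P (\bigcup_i A i) <= (#|I|%:R * e)%:E)%E.
Proof.
move=> Ae.
have H s : (mu_ext P (\bigcup_(i in [set` s]) A i) <= ((size s)%:R * e)%:E)%E.
  elim: s => [|i s IH].
    rewrite (_ : \bigcup_(i in _) _ = set0) ?outer_measure0 ?mul0r//.
    by rewrite -subset0 => x [i].
  apply: (@le_trans _ _ (mu_ext P (A i `|` \bigcup_(j in [set` s]) A j))).
    apply: le_mu_ext => x [j /=]; rewrite inE => /predU1P[->|js] Aj; first by left.
    by right; exists j.
  rewrite (le_trans (mu_extU _ _))// -natr1 mulrDl mul1r addrC EFinD leeD//.
have := H (enum I); rewrite -cardE; apply: le_trans; apply: le_mu_ext.
by move=> x [i _ Ai]; exists i => //=; rewrite mem_enum.
Qed.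

Lemma mu_ext_fin_num (A : set Omega) : mu_ext P A \is a fin_num.
Proof.
rewrite ge0_fin_numE ?mu_ext_ge0//.
apply: (@le_lt_trans _ _ (mu_ext P setT)); first exact: le_mu_ext.
have -> : mu_ext P setT = P setT by apply: measurable_mu_extE; exact: measurableT.
by rewrite probability_setT ltry.
Qed.

Lemma with_high_probabilityP (E : R -> set Omega) :
  with_high_probability P E <->
  forall e, 0 < e -> \forall lambda \near +oo, (mu_ext P (~` E lambda) <= e%:E)%E.
Proof.
rewrite /with_high_probability; split=> [/fine_cvgP[_ h] e e0|H].
  move/cvgrPdist_le : h => /(_ e e0); apply: filterS => lambda /=.
  rewrite sub0r normrN ger0_norm ?fine_ge0 ?mu_ext_ge0// => h.
  by rewrite -(fineK (mu_ext_fin_num _)) lee_fin.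
apply/fine_cvgP; split; first by apply: nearW => lambda; exact: mu_ext_fin_num.
apply/cvgrPdist_le => e e0; move: (H e e0); apply: filterS => lambda h /=.
rewrite sub0r normrN ger0_norm ?fine_ge0 ?mu_ext_ge0//.
by rewrite -lee_fin fineK// mu_ext_fin_num.
Qed.

End outer_probability.

(** * Integrals *)

Section one_dimensional_integrals.
Context {R : realType}.
Local Notation mu := (@lebesgue_measure R).

Lemma integral_exp_tail (rho b : R) : 0 < rho ->
  (\int[mu]_(t in `[b, +oo[) (expR (- rho * t))%:E)%E = (expR (- rho * b) / rho)%:E.
Proof.
move=> rho0.
have cE : continuous (fun t : R => expR (- rho * t)).
  move=> t; apply: (@continuous_comp _ _ _ (fun t => - rho * t) expR).
    exact: mulrl_continuous.
  exact: continuous_expR.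
have dF (t : R) : is_derive t 1 (fun t => - (expR (- rho * t) / rho)) (expR (- rho * t)).
  apply: is_derive_eq.
  rewrite /GRing.scale/= !(scaler0, addr0, add0r, mulr0, mul0r, mulr1).
  have rn0 : rho != 0 by rewrite gt_eqF.
  by field.
rewrite (@ge0_continuous_FTC2y _ _ (fun t => - (expR (- rho * t) / rho)) _ 0)//.
- by rewrite EFinN oppeK add0e.
- exact: continuous_subspaceT.
- rewrite -oppr0; apply: cvgN; rewrite -[X in _ --> X](mul0r rho^-1).
  apply: cvgMr_tmp.
  rewrite (_ : (fun x => expR (- rho * x)) =
               (fun z => expR (- z)) \o (fun z => rho * z)); last first.
    by apply/funext => x; rewrite /= mulNr.
  apply: (@cvg_comp _ _ _ _ _ _ (pinfty_nbhs R)); last exact: cvgr_expR.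
  exact: gt0_cvgMry.
- by apply: cvgN; apply: cvgMr_tmp; apply/cvg_at_right_filter; exact: cE.
- by move=> t _; rewrite derive1E derive_val.
Qed.

Lemma integral_exp_head (b : R) :
  (\int[mu]_(t in `]-oo, b]) (expR t)%:E)%E = (expR b)%:E.
Proof.
rewrite -{1}(opprK b) ge0_integration_by_substitutionNy//; last first.
  by apply: continuous_subspaceT => t; exact: continuous_expR.
under eq_integral => t _ do rewrite /= -[- t]mulN1r.
by rewrite integral_exp_tail// mulrNN mul1r divr1.
Qed.

(** This is the normal distribution of variance 2. *)
Lemma integral_gauss_quarter_fin :
  exists J : R, (\int[mu]_t (expR (- t ^+ 2 / 4))%:E)%E = J%:E.
Proof.
pose s : R := Num.sqrt 2.
have s2 : s ^+ 2 = 2 by rewrite sqr_sqrtr.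
have s0 : s != 0 by rewrite sqrtr_eq0 -ltNge.
have pk := normal_peak_gt0 s0.
exists (normal_peak s)^-1.
have -> : (fun t : R => (expR (- t ^+ 2 / 4))%:E) =
          (fun t => ((normal_peak s)^-1)%:E * (normal_pdf 0 s t)%:E)%E.
  apply/funext => t; rewrite normal_pdfE// /normal_fun s2 subr0 -EFinM mulKf ?gt_eqF//.
  by rewrite -[2 *+ 2]mulr_natr -natrM.
rewrite ge0_integralZl_EFin//.
- by rewrite integral_normal_pdf mule1.
- by move=> t _; rewrite lee_fin normal_pdf_ge0.
- by apply/measurable_EFinP; exact: measurable_normal_pdf.
- by rewrite invr_ge0 ltW.
Qed.

End one_dimensional_integrals.

Section lebesgue_integrals.
Context {R : realType}.
Local Notation mu := (@lebesgue_measure R).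

Lemma measurable_enorm2 n : measurable_fun [set: 'rV[R]_n] (fun v => enorm v ^+ 2).
Proof.
rewrite (_ : (fun v => _) = fun v : 'rV[R]_n => \sum_i v ord0 i ^+ 2); last first.
  by apply/funext => v; rewrite sqr_enorm; apply: eq_bigr => i _; rewrite expr2.
apply: measurable_sum => i; apply: measurable_funX; exact: measurable_rv_coord.
Qed.

Lemma measurable_rv_head n : measurable_fun [set: 'rV[R]_n.+1] (@rv_head R n).
Proof.
apply: measurable_fun_rv => j.
rewrite (_ : (fun t => _) = fun v : 'rV[R]_n.+1 => v ord0 (lift ord_max j)).
  exact: measurable_rv_coord.
by apply/funext => v; rewrite mxE.
Qed.

Lemma rv_lebesgueS n : (@rv_lebesgue R n.+1 : set _ -> \bar R) =
  pushforward (@rv_lebesgue R n \x mu)%E (fun p => rv_rcons p.1 p.2).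
Proof. by []. Qed.

Lemma integral_rv_lebesgueS n (B : set 'rV[R]_n.+1) (f : 'rV[R]_n.+1 -> \bar R) :
  measurable B -> measurable_fun B f -> (forall x, B x -> (0 <= f x)%E) ->
  (\int[@rv_lebesgue R n.+1]_(x in B) f x =
   \int[(@rv_lebesgue R n \x mu)%E]_(p in (fun p => rv_rcons p.1 p.2) @^-1` B)
     f (rv_rcons p.1 p.2))%E.
Proof.
move=> mB mf f0; rewrite rv_lebesgueS.
have f0' : {in B, forall y, (0 <= f y)%E} by move=> y /set_mem; exact: f0.
have H := fun phi mphi => @ge0_integral_pushforward _ _ _ _ R phi mphi
  (@rv_lebesgue R n \x mu)%E B f mB mf f0'.
exact: (H (fun p => rv_rcons p.1 p.2) (@measurable_rv_rcons R n)).
Qed.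

(** Tonelli on a set given by its vertical sections. *)
Lemma integral_sections d (T : measurableType d)
    (m : {sigma_finite_measure set T -> \bar R}) (D : set (T * R)) (f : T * R -> \bar R) :
  measurable D -> measurable_fun setT f -> (forall p, (0 <= f p)%E) ->
  (\int[(m \x mu)%E]_(p in D) f p =
   \int[m]_v \int[mu]_(t in [set t | D (v, t)]) f (v, t))%E.
Proof.
move=> mD mf f0; 
have mfD := (measurable_restrictT f mD).1 (measurable_funTS mf).
rewrite integral_mkcond fubini_tonelli1.
- apply: eq_integral => v _; rewrite /fubini_F [RHS]integral_mkcond.
  by apply: eq_integral => t _; rewrite /patch; reflexivity.
- exact: mfD.
- by move=> p; exact: erestrict_ge0.
Qed.

Lemma gauss_quarter_fin n :
  exists J : R, (\int[@rv_lebesgue R n]_v (expR (- enorm v ^+ 2 / 4))%:E)%E = J%:E.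
Proof.
have mE k : measurable_fun setT (fun v : 'rV[R]_k => (expR (- enorm v ^+ 2 / 4))%:E).
  apply/measurable_EFinP; apply: measurableT_comp; first exact: measurable_expR.
  apply: measurable_funM => //; apply: measurableT_comp => //.
  exact: measurable_enorm2.
have [j jE] := @integral_gauss_quarter_fin R.
elim: n => [|n [J IH]].
  exists (expR (- enorm (0 : 'rV[R]_0) ^+ 2 / 4)).
  by rewrite (integral_dirac (0 : 'rV[R]_0) measurableT (mE 0%N)) diracT mul1e.
exists (J * j); rewrite integral_rv_lebesgueS//.
have m1 := measurableT_comp (mE n.+1) (@measurable_rv_rcons R n).
rewrite preimage_setT (integral_sections _ measurableT m1)//=.
transitivity (\int[@rv_lebesgue R n]_v (j%:E * (expR (- enorm v ^+ 2 / 4))%:E))%E.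
  apply: eq_integral => v _.
  under eq_integral => t _ do rewrite /= sqr_enorm_split rv_head_rcons rv_last_rcons
    opprD mulrDl expRD EFinM.
  rewrite ge0_integralZl_EFin ?expR_ge0//; first by rewrite jE muleC.
    exact: measurableT.
  apply/measurable_EFinP; apply: measurableT_comp; first exact: measurable_expR.
  by apply: measurable_funM => //; apply: measurableT_comp.
have j0 : 0 <= j.
  by rewrite -lee_fin -jE; apply: integral_ge0 => t _; rewrite lee_fin expR_ge0.
rewrite ge0_integralZl_EFin//; last exact: mE.
by rewrite IH -EFinM mulrC.
Qed.

End lebesgue_integrals.

(** * Expected numbers of points *)

Section rare_points.
Context {R : realType}.
Variable n : nat.
Local Notation mu := (@lebesgue_measure R).

(** The factor 1 / 4, half of the curvature of the paraboloid, leaves an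
    integrable weight e^(- |v|^2 / 4) after the height is integrated out, while
    the threshold still grows faster than any affine function. *)
Definition low_limit_points (A : R) : set ('rV[R]_n * R) :=
  [set p | (unbend p).2 <= - A + enorm p.1 ^+ 2 / 4].

Definition low_gaussian_points (A r : R) : set 'rV[R]_n.+1 :=
  [set x | (flat r x).2 <= - A + enorm (rv_head x) ^+ 2 / 4].

Lemma measurable_low_limit_points A : measurable (low_limit_points A).
Proof.
have m1 : measurable_fun setT (fun p : 'rV[R]_n * R => enorm p.1 ^+ 2).
  exact: (measurableT_comp (@measurable_enorm2 R n) measurable_fst).
rewrite -[X in measurable X]setTI; apply: measurable_fun_le => //.
- by apply: measurable_funD => //; apply: measurable_funM.
- by apply: measurable_funD => //; apply: measurable_funM.
Qed.

Lemma measurable_low_gaussian_points A r : measurable (low_gaussian_points A r).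
Proof.
have m1 : measurable_fun setT (fun x : 'rV[R]_n.+1 => enorm (rv_head x) ^+ 2).
  exact: (measurableT_comp (@measurable_enorm2 R n) (@measurable_rv_head R n)).
rewrite -[X in measurable X]setTI; apply: measurable_fun_le => //.
- apply: measurable_funB => //; apply: measurable_funM => //.
  exact: measurable_rv_coord.
- by apply: measurable_funD => //; apply: measurable_funM.
Qed.

Lemma limit_intensity_low (J A : R) :
  (\int[@rv_lebesgue R n]_v (expR (- enorm v ^+ 2 / 4))%:E)%E = J%:E ->
  limit_intensity (low_limit_points A) = (expR (- A) * J)%:E.
Proof.
move=> JE; rewrite /limit_intensity integral_sections; last first.
- by move=> p; rewrite lee_fin expR_ge0.
- by apply/measurable_EFinP; apply: measurableT_comp => //; exact: measurable_expR.
- exact: measurable_low_limit_points.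
transitivity (\int[@rv_lebesgue R n]_v
    ((expR (- A))%:E * (expR (- enorm v ^+ 2 / 4))%:E))%E.
  apply: eq_integral => v _.
  rewrite (_ : [set t | _] = `]-oo, (- A - enorm v ^+ 2 / 4)]%classic); last first.
    apply/seteqP; split => t; rewrite /low_limit_points/= in_itv/=; lra.
  by rewrite [LHS]integral_exp_head -EFinM -expRD mulNr.
rewrite ge0_integralZl_EFin ?expR_ge0//.
  by rewrite JE EFinM.
apply/measurable_EFinP; apply: measurableT_comp; first exact: measurable_expR.
apply: measurable_funM => //; apply: measurableT_comp => //.
exact: measurable_enorm2.
Qed.

Lemma gaussian_density_ge0 (x : 'rV[R]_n.+1) : 0 <= gaussian_density x.
Proof. by rewrite mulr_ge0 ?powR_ge0 ?expR_ge0. Qed.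

Lemma measurable_gaussian_density lambda :
  measurable_fun setT (fun x : 'rV[R]_n.+1 => (lambda * gaussian_density x)%:E).
Proof.
apply/measurable_EFinP; apply: measurable_funM => //.
apply: measurable_funM => //; apply: measurableT_comp; first exact: measurable_expR.
apply: measurable_funM => //; apply: measurableT_comp => //.
exact: measurable_enorm2.
Qed.

(** The tangent-line bound t^2 / 2 >= r t - r^2 / 2 turns the Gaussian into the
    exponential profile of the limit process. *)
Lemma gaussian_intensity_low (J A lambda r : R) : 0 <= lambda -> 0 < r ->
  (\int[@rv_lebesgue R n]_v (expR (- enorm v ^+ 2 / 4))%:E)%E = J%:E ->
  (gaussian_intensity lambda (low_gaussian_points A r) <=
   (lambda * (2 * pi) `^ (- n.+1%:R / 2) * expR (- r ^+ 2 / 2) / r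
     * (expR (- A) * J))%:E)%E.
Proof.
move=> l0 r0 JE; rewrite /gaussian_intensity integral_rv_lebesgueS; last first.
- by move=> x _; rewrite lee_fin mulr_ge0// gaussian_density_ge0.
- by apply: measurable_funTS; exact: measurable_gaussian_density.
- exact: measurable_low_gaussian_points.
have m1 := measurableT_comp (measurable_gaussian_density lambda) (@measurable_rv_rcons R n).
have m2 := @measurable_rv_rcons R n measurableT _ (measurable_low_gaussian_points A r).
rewrite setTI in m2.
set D : R := (2 * pi) `^ _; have D0 : 0 <= D by exact: powR_ge0.
pose g (p : 'rV[R]_n * R) : \bar R :=
  ((lambda * D * expR (- enorm p.1 ^+ 2 / 2 + r ^+ 2 / 2))%:E * (expR (- r * p.2))%:E)%E.
have g0 p : (0 <= g p)%E by rewrite /g -EFinM lee_fin !mulr_ge0 ?expR_ge0.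
have m3 : measurable_fun setT (fun p : 'rV[R]_n * R => enorm p.1 ^+ 2).
  exact: (measurableT_comp (@measurable_enorm2 R n) measurable_fst).
have mg : measurable_fun setT g.
  apply/measurable_EFinP; apply: measurable_funM.
    apply: measurable_funM => //; apply: measurableT_comp; first exact: measurable_expR.
    apply: measurable_funD => //; apply: measurable_funM => //.
    exact: measurableT_comp.
  apply: measurableT_comp; first exact: measurable_expR.
  exact: measurable_funM.
have mE : measurable_fun setT (fun v : 'rV[R]_n => (expR (- enorm v ^+ 2 / 4))%:E).
  apply/measurable_EFinP; apply: measurableT_comp; first exact: measurable_expR.
  apply: measurable_funM => //; apply: measurableT_comp => //.
  exact: measurable_enorm2.
apply: (@le_trans _ _ (\int[(@rv_lebesgue R n \x mu)%E]_(p in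
    (fun p : 'rV[R]_n * R => rv_rcons p.1 p.2) @^-1` low_gaussian_points A r) g p)%E).
  apply: ge0_le_integral; first exact: m2.
  - by move=> p _; rewrite lee_fin mulr_ge0// gaussian_density_ge0.
  - exact: measurable_funTS m1.
  - exact: measurable_funTS mg.
  move=> p _; rewrite /g -EFinM lee_fin /gaussian_density sqr_enorm_split.
  rewrite rv_head_rcons rv_last_rcons -/D -!mulrA ler_wpM2l// ler_wpM2l// -expRD ler_expR.
  by have := sqr_ge0 (p.2 - r); lra.
rewrite (integral_sections _ m2 mg)//.
rewrite le_eqVlt; apply/orP; left; apply/eqP.
set c := lambda * D * expR (- r ^+ 2 / 2) / r.
have c0 : 0 <= c by rewrite /c !mulr_ge0 ?expR_ge0 ?invr_ge0// ltW.
transitivity (\int[@rv_lebesgue R n]_v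
    ((c * expR (- A))%:E * (expR (- enorm v ^+ 2 / 4))%:E))%E; last first.
  have cA0 : 0 <= c * expR (- A) by rewrite mulr_ge0// expR_ge0.
  rewrite ge0_integralZl_EFin//.
  by rewrite JE -EFinM mulrA.
apply: eq_integral => v _.
rewrite (_ : [set t | _] = `[((r ^+ 2 + A - enorm v ^+ 2 / 4) / r), +oo[%classic); last first.
  apply/seteqP; split => t; rewrite /low_gaussian_points/= rv_head_rcons rv_last_rcons;
    rewrite in_itv/= andbT ler_pdivrMr//; lra.
have lD0 : 0 <= lambda * D * expR (- enorm v ^+ 2 / 2 + r ^+ 2 / 2).
  by rewrite !mulr_ge0 ?expR_ge0.
rewrite /g/= ge0_integralZl_EFin//; last first.
  apply: measurable_funTS; apply/measurable_EFinP.
  by apply: measurableT_comp; [exact: measurable_expR|exact: measurable_funM].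
rewrite integral_exp_tail// -!EFinM; congr EFin.
rewrite /c; set e1 := expR _; set e2 := expR (- r * _).
have -> : lambda * D * expR (- r ^+ 2 / 2) / r * expR (- A) * expR (- enorm v ^+ 2 / 4)
    = lambda * D / r * (expR (- r ^+ 2 / 2) * expR (- A) * expR (- enorm v ^+ 2 / 4)).
  by ring.
have -> : lambda * D * e1 * (e2 / r) = lambda * D / r * (e1 * e2) by ring.
congr (_ * _); rewrite /e1 /e2 -!expRD; congr expR.
by field; rewrite gt_eqF.
Qed.

End rare_points.

Definition signed_cube (R : realType) n (a : R) (sigma : 'I_n -> bool) :
    set 'rV[R]_n :=
  [set v | forall i, a <= (-1) ^+ sigma i * v ord0 i <= a + 1].

Section boxes.
Context {R : realType}.
Local Notation mu := (@lebesgue_measure R).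

Lemma signed_interval (a t : R) (b : bool) :
  (a <= (-1) ^+ b * t <= a + 1) =
  (t \in if b then `[(- (a + 1)), (- a)] else `[a, (a + 1)]).
Proof.
case: b; rewrite in_itv/= ?(expr0, expr1, mul1r, mulN1r)//.
by rewrite lerNr lerNl andbC.
Qed.

Lemma measurable_signed_cube n a (sigma : 'I_n -> bool) :
  measurable (@signed_cube R n a sigma).
Proof.
rewrite (_ : signed_cube a sigma = \bigcap_(i in [set: 'I_n])
    ((fun v : 'rV[R]_n => v ord0 i) @^-1`
      [set` if sigma i then `[(- (a + 1)), (- a)] else `[a, (a + 1)]])).
  apply: fin_bigcap_measurable => // i _; rewrite -[X in measurable X]setTI.
  apply: measurable_rv_coord => //; by case: (sigma i).
apply/seteqP; split => v h i; last by rewrite signed_interval; exact: h.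
by move=> _ /=; rewrite -signed_interval; exact: h.
Qed.

Lemma rv_lebesgue_signed_cube n a (sigma : 'I_n -> bool) :
  @rv_lebesgue R n (signed_cube a sigma) = 1%E.
Proof.
elim: n sigma => [|n IH] sigma.
  by rewrite /= diracE mem_set// => -[].
pose I : set R := [set` if sigma ord_max then `[(- (a + 1)), (- a)] else `[a, (a + 1)]].
have mI : measurable I by rewrite /I; case: (sigma ord_max).
rewrite rv_lebesgueS /pushforward.
rewrite (_ : _ @^-1` _ = signed_cube a (sigma \o lift ord_max) `*` I); last first.
  apply/seteqP; split => [[v t] h|[v t] [hv ht] i] /=.
    split=> [j|]; first by have := h (lift ord_max j); rewrite rv_rcons_lift.
    by have := h ord_max; rewrite -/(rv_last _) rv_last_rcons signed_interval.
  case: (unliftP ord_max i) => [j|] ->; first by rewrite rv_rcons_lift; exact: hv.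
  by rewrite -/(rv_last _) rv_last_rcons signed_interval; exact: ht.
rewrite product_measure1E//; last exact: measurable_signed_cube.
rewrite [X in (X * _)%E]IH mul1e /I; case: (sigma ord_max) => /=; rewrite lebesgue_measure_itv/= lte_fin.
  by rewrite ifT; [rewrite -EFinD; congr EFin; ring|lra].
by rewrite ifT; [rewrite -EFinD; congr EFin; ring|lra].
Qed.

Lemma lower_boxE n (L H0 : R) (sigma : 'I_n -> bool) :
  lower_box L H0 sigma = signed_cube (L + 1) sigma `*` `[0, H0]%classic.
Proof.
have e : L + 2 = L + 1 + 1 by ring.
by rewrite /lower_box e; apply/seteqP; split=> p [h1 h2]; split=> //=;
  move: h2; rewrite in_itv/=.
Qed.

Lemma measurable_lower_box n (L H0 : R) (sigma : 'I_n -> bool) :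
  measurable (lower_box L H0 sigma).
Proof. by rewrite lower_boxE; apply: measurableX => //; exact: measurable_signed_cube. Qed.

Lemma limit_intensity_lower_box n (L H0 : R) (sigma : 'I_n -> bool) : 0 <= H0 ->
  (H0%:E <= limit_intensity (lower_box L H0 sigma))%E.
Proof.
move=> H00; have mB := measurable_lower_box L H0 sigma.
apply: (@le_trans _ _ (\int[(@rv_lebesgue R n \x mu)%E]_(w in lower_box L H0 sigma) (cst 1 w))%E).
  rewrite integral_cst//.
  have e := product_measure1E (@rv_lebesgue R n) mu
    (measurable_signed_cube (L + 1) sigma) (measurable_itv `[0, H0]).
  have l : (H0%:E <= mu `[0%R, H0]%classic)%E.
    rewrite lebesgue_measure_itv/= lte_fin.
    by case: ltP => [_|h]; [rewrite -EFinD subr0|rewrite lee_fin].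
  suff h : (H0%:E <= (@rv_lebesgue R n \x mu)%E
      (signed_cube (L + 1) sigma `*` `[0%R, H0]%classic))%E.
    by rewrite mul1e lower_boxE; exact: h.
  rewrite e [X in (X * _)%E]rv_lebesgue_signed_cube mul1e; exact: l.
apply: ge0_le_integral => //.
  apply: measurable_funTS; apply/measurable_EFinP.
  by apply: measurableT_comp => //; exact: measurable_expR.
move=> w [_ /andP[w0 _]]; rewrite lee_fin -expR0 ler_expR; exact: w0.
Qed.

(** The density is bounded below on the cubes, which are bounded. *)
Lemma gaussian_intensity_signed_cube n (a : R) : 0 <= a ->
  exists2 k : R, 0 < k & forall (lambda : R) (sigma : 'I_n.+1 -> bool), 0 <= lambda ->
    ((lambda * k)%:E <= gaussian_intensity lambda (signed_cube a sigma))%E.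
Proof.
move=> a0; pose w : R := n.+1%:R * (a + 1) ^+ 2.
exists ((2 * pi) `^ (- n.+1%:R / 2) * expR (- w / 2)).
  by rewrite mulr_gt0 ?expR_gt0// powR_gt0// mulr_gt0// pi_gt0.
move=> lambda sigma l0; have mB := measurable_signed_cube a sigma.
rewrite /gaussian_intensity; set c := lambda * _.
apply: (@le_trans _ _ (\int[@rv_lebesgue R n.+1]_(x in signed_cube a sigma) (cst c%:E x))%E).
  by rewrite integral_cst// [X in (_ * X)%E]rv_lebesgue_signed_cube mule1.
apply: ge0_le_integral => //.
- by move=> x _; rewrite lee_fin /c !mulr_ge0 ?powR_ge0 ?expR_ge0.
- by apply: measurable_funTS; exact: measurable_gaussian_density.
move=> x xB; rewrite lee_fin /c ler_wpM2l// ler_wpM2l ?powR_ge0// ler_expR.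
suff : enorm x ^+ 2 <= w by lra.
rewrite sqr_enorm /dot (le_trans (y := \sum_(i < n.+1) (a + 1) ^+ 2))//; last first.
  by rewrite sumr_const card_ord /w mulr_natl.
apply: ler_sum => i _; have /andP[] := xB i.
by case: (sigma i); rewrite ?(expr0, expr1, mul1r, mulN1r) => ? ?; nra.
Qed.

End boxes.

(** * Asymptotics of the scaling radius *)

Section scaling_radius_asymptotics.
Context {R : realType}.
Variable n : nat.

Lemma near_ln_ge (T : R) : \forall lambda \near +oo, T <= ln lambda /\ 0 < lambda.
Proof.
near=> lambda; have h : expR T <= lambda.
  by near: lambda; apply: nbhs_pinfty_ge; exact: num_real.
have l0 : 0 < lambda by rewrite (lt_le_trans _ h)// expR_gt0.
split=> //; rewrite -(expRK T) ler_ln// posrE; exact: expR_gt0.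
Unshelve. all: by end_near. Qed.

(** With t = ln lambda, the squared radius is 2 t - ln (C t), and ln t <= t. *)
Lemma scaling_radius_sqr (lambda : R) :
  let C := 2 * (2 * pi) ^+ n.+1 in
  1 <= ln lambda -> 2 * `|ln C| <= ln lambda ->
  scaling_radius n lambda ^+ 2 = 2 * ln lambda - ln (C * ln lambda) /\
  ln lambda / 2 <= scaling_radius n lambda ^+ 2.
Proof.
move=> C t1 tC; rewrite /scaling_radius -/C; set t := ln lambda in t1 tC *.
have t0 : 0 < t by lra.
have C0 : 0 < C by rewrite mulr_gt0// exprn_gt0// mulr_gt0// pi_gt0.
have lnC : ln (C * t) <= t / 2 + t.
  rewrite lnM ?posrE// lerD//.
    by have := ler_norm (ln C); lra.
  by have := @expR_ge1Dx R (ln t); rewrite lnK ?posrE//; lra.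
have h : t / 2 <= 2 * t - ln (C * t) by lra.
rewrite sqr_sqrtr//; lra.
Qed.

(** The square of [lambda (2 pi)^(- d / 2) e^(- r^2 / 2)] is exactly
    [2 ln lambda], by the choice of the radius, and [ln lambda <= 2 r^2]. *)
Lemma near_scaling_radius (M : R) : \forall lambda \near +oo,
  [/\ 0 < lambda, 0 < scaling_radius n lambda, M <= scaling_radius n lambda
    & lambda * (2 * pi) `^ (- n.+1%:R / 2) * expR (- scaling_radius n lambda ^+ 2 / 2)
      / scaling_radius n lambda <= 2].
Proof.
pose C : R := 2 * (2 * pi) ^+ n.+1.
have C0 : 0 < C by rewrite mulr_gt0// exprn_gt0// mulr_gt0// pi_gt0.
have := near_ln_ge (1 + 2 * `|ln C| + 2 * M ^+ 2); apply: filterS => lambda [lT l0].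
have nC := normr_ge0 (ln C); have M2 := sqr_ge0 M.
have [] := @scaling_radius_sqr lambda; [lra|rewrite -/C; lra|].
rewrite -/C; set r := scaling_radius n lambda; set t := ln lambda in lT *.
move=> rE rt; have t0 : 0 < t by lra.
have r0' : 0 <= r by exact: sqrtr_ge0.
have r0 : 0 < r.
  by rewrite lt_def r0' andbT; apply/eqP => rz; move: rt; rewrite rz expr0n/=; lra.
have Mr : M <= r.
  have [M0|M0] := lerP M 0; first exact: le_trans M0 r0'.
  by rewrite -(ler_pXn2r (ltn0Sn 1)) ?nnegrE ?(ltW M0)//; lra.
split=> //; rewrite ler_pdivrMr//; set c := lambda * _ * _.
have c0 : 0 <= c by rewrite /c !mulr_ge0 ?powR_ge0 ?expR_ge0// ltW.
rewrite -(ler_pXn2r (ltn0Sn 1)) ?nnegrE ?c0 ?mulr_ge0//.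
suff -> : c ^+ 2 = 2 * t by rewrite exprMn; lra.
have p2 : 0 < 2 * pi :> R by rewrite mulr_gt0// pi_gt0.
have e1 : ((2 * pi) `^ (- n.+1%:R / 2)) ^+ 2 = ((2 * pi) ^+ n.+1)^-1 :> R.
  rewrite -powR_mulrn ?powR_ge0// -powRrM divfK// powRN powR_mulrn//; exact: ltW.
have e2 : expR (- r ^+ 2 / 2) ^+ 2 = (lambda ^+ 2)^-1 * (C * t).
  rewrite -expRM_natl (_ : 2%:R * _ = - (2%:R * t) + ln (C * t)); last by lra.
  have Ct0 : C * t \is Num.pos by rewrite posrE mulr_gt0.
  by rewrite expRD (lnK Ct0) expRN expRM_natl /t lnK// posrE.
rewrite /c !exprMn e1 e2 /C; field.
by rewrite gt_eqF//= gt_eqF// exprn_gt0.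
Qed.

End scaling_radius_asymptotics.

(** * Convergence *)

Section convergence.
Context {R : realType}.

Lemma compact_window n (M H : R) : compact (@window R n M H).
Proof.
rewrite (_ : window M H = eball (n := n) M `*` [set` `[(- H), H]]); last first.
  apply/seteqP; split=> p [pM pH]; split => //.
    by rewrite /= in_itv/= -ler_norml.
  by move: pH; rewrite /= in_itv/= -ler_norml.
apply: compact_setX; last exact: segment_compact.
apply: bounded_closed_compact; last first.
  exact: (closed_comp (fun v _ => @continuous_enorm R n v) (@closed_le R M)).
exists M; split; first exact: num_real.
move=> x Mx v vM; apply: le_trans (ltW Mx).
have M0 : 0 <= M := le_trans (enorm_ge0 v) vM.
rewrite [leLHS]mx_normrE; apply/bigmax_leP; split => // -[i j] _ /=.
by rewrite ord1; exact: le_trans (abs_coord_le v j) vM.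
Qed.

(** Used to make a multiple [a] of an exponential small: [x <= e^x] for
    [x = a / c]. *)
Lemma mul_expRN_le (a c : R) : 0 < c -> a * expR (- (a / c)) <= c.
Proof.
move=> c0; have e0 := expR_gt0 (a / c).
rewrite expRN ler_pdivrMr// mulrC -ler_pdivrMr//.
by have := expR_ge1Dx (a / c); lra.
Qed.

End convergence.

Theorem theorem1p2 (R : realType) (n : nat) (L lambda0 : R)
    (dOmega : measure_display) (Omega : measurableType dOmega)
    (P : probability Omega R)
    (Plambda : R -> Omega -> set 'rV[R]_n.+1)
    (Plim : Omega -> set ('rV[R]_n * R)) :
  (2 <= n.+1)%N ->
  0 < L ->
  (forall lambda, lambda0 <= lambda -> 1 <= scaling_radius n lambda) ->
  (forall lambda, lambda0 <= lambda ->
     poisson_point_process P (Plambda lambda) (gaussian_intensity lambda)) ->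
  poisson_point_process P Plim (@limit_intensity R n) ->
  (forall D : set ('rV[R]_n * R), compact D ->
     with_high_probability P (fun lambda => [set omega |
       (scaling lambda @` Plambda lambda omega) `&` D = Plim omega `&` D])) ->
  forall epsilon : R, 0 < epsilon ->
    with_high_probability P (fun lambda => [set omega |
      exists f g : 'rV[R]_n -> R,
        [/\ continuous_graph_on (eball (n := n) L)
              (scaling lambda @` boundary (convex_hull (Plambda lambda omega)))
              f,
            continuous_graph_on (eball (n := n) L)
              (boundary (paraboloid_hull (Plim omega))) g
          & (sup_dist (eball (n := n) L) f g <= epsilon%:E)%E]]).
Proof.
move=> n1 L0 _ pppl ppp coupling eps eps0.
have n0 : (0 < n)%N by [].
apply/with_high_probabilityP => e e0; have e4 : 0 < e / 4 by rewrite divr_gt0.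
have [J JE] := @gauss_quarter_fin R n.
have J0 : 0 <= J.
  by rewrite -lee_fin -JE; apply: integral_ge0 => v _; rewrite lee_fin expR_ge0.
pose A := 3 * J / (e / 4).
have A0 : 0 <= A by rewrite divr_ge0 ?mulr_ge0// ltW.
have AJ : 3 * J * expR (- A) <= e / 4 by exact: mul_expRN_le.
pose N4 : R := #|{ffun 'I_n -> bool}|%:R.
pose H0 := N4 / (e / 4).
have H00 : 0 <= H0 by rewrite divr_ge0// ltW.
have [M [H [r1 good]]] := hull_boundary_close n0 L0 A0 H00 eps0.
have [k k0 cubeL] : exists2 k : R, 0 < k & forall (lambda : R)
    (sigma : 'I_n.+1 -> bool), 0 <= lambda ->
    ((lambda * k)%:E <= gaussian_intensity lambda (signed_cube (L + 1) sigma))%E.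
  by apply: gaussian_intensity_signed_cube; rewrite addr_ge0// ltW.
pose N5 : R := #|{ffun 'I_n.+1 -> bool}|%:R.
have F3 := (with_high_probabilityP P _).1 (coupling _ (@compact_window R n M H)) _ e4.
have F3' := near_scaling_radius n r1.
have F5 : \forall lambda \near +oo, N5 / (e / 4) / k <= lambda :> R.
  by apply: nbhs_pinfty_ge; exact: num_real.
have Fl : \forall lambda \near +oo, lambda0 <= lambda :> R.
  by apply: nbhs_pinfty_ge; exact: num_real.
apply: filterS2 (filterI F3 F3') (filterI F5 Fl).
move=> lambda [c3 [l0 r0 rr1 dens]] [l5 ll0].
have {}pppl := pppl _ ll0.
set r := scaling_radius n lambda in r0 rr1 dens.
(* The five exceptional events: a point of either process is too low, the
   processes differ in the window, or a covering point is missing from either. *)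
pose B1 := [set omega | Plim omega `&` low_limit_points A != set0].
pose B2 := [set omega | Plambda lambda omega `&` low_gaussian_points A r != set0].
pose B3 := ~` [set omega | (scaling lambda @` Plambda lambda omega) `&` window M H
                           = Plim omega `&` window M H].
pose B4 := \bigcup_(sigma : {ffun 'I_n -> bool})
  [set omega | Plim omega `&` lower_box L H0 sigma = set0].
pose B5 := \bigcup_(tau : {ffun 'I_n.+1 -> bool})
  [set omega | Plambda lambda omega `&` signed_cube (L + 1) tau = set0].
have b1 : (mu_ext P B1 <= (expR (- A) * J)%:E)%E.
  apply: (hit_probability_le ppp (measurable_low_limit_points A)).
    by rewrite (limit_intensity_low A JE) lee_fin mulr_ge0// expR_ge0.
  by rewrite (limit_intensity_low A JE).
have b2 : (mu_ext P B2 <= (2 * (expR (- A) * J))%:E)%E.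
  apply: (hit_probability_le pppl (measurable_low_gaussian_points A r)).
    apply: integral_ge0 => x _.
    by rewrite lee_fin mulr_ge0 ?gaussian_density_ge0// ltW.
  apply: le_trans (gaussian_intensity_low A (ltW l0) r0 JE) _.
  by rewrite lee_fin ler_wpM2r// mulr_ge0// expR_ge0.
have b4 : (mu_ext P B4 <= (e / 4)%:E)%E.
  apply: (@le_trans _ _ (N4 * expR (- H0))%:E); last by rewrite lee_fin mul_expRN_le.
  apply: mu_ext_finU => sigma.
  apply: (void_probability_le ppp (measurable_lower_box L H0 sigma)) => //.
  exact: limit_intensity_lower_box.
have b5 : (mu_ext P B5 <= (e / 4)%:E)%E.
  have N5k : N5 / (e / 4) <= lambda * k by rewrite -ler_pdivrMr.
  have N50 : 0 <= N5 / (e / 4) by rewrite divr_ge0// ltW.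
  apply: (@le_trans _ _ (N5 * expR (- (N5 / (e / 4))))%:E).
    apply: mu_ext_finU => tau.
    apply: (void_probability_le pppl (measurable_signed_cube (L + 1) tau)) => //.
    by apply: le_trans (cubeL _ _ (ltW l0)); rewrite lee_fin.
  by rewrite lee_fin mul_expRN_le.
apply: (@le_trans _ _ (mu_ext P (B1 `|` (B2 `|` (B3 `|` (B4 `|` B5)))))).
  apply: le_mu_ext => omega bad; apply: contrapT => /not_orP[nb1 /not_orP[nb2
    /not_orP[nb3 /not_orP[nb4 nb5]]]]; apply: bad.
  apply: good rr1 _ _ _ _ _ _ _.
  - move=> p Yp; rewrite leNgt; apply/negP => /ltW h; apply: nb1.
    by apply/set0P; exists p.
  - move=> x Xx; rewrite leNgt; apply/negP => /ltW h; apply: nb2.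
    by apply/set0P; exists x.
  - exact: contrapT nb3.
  - move=> sigma; apply/set0P/eqP => h; apply: nb4.
    exists [ffun i => sigma i] => //=.
    by rewrite (_ : fun_of_fin _ = sigma)//; apply/funext => i; rewrite ffunE.
  - move=> tau; apply: contrapT => h; apply: nb5.
    exists [ffun i => tau i] => //=.
    rewrite (_ : fun_of_fin _ = tau); last by apply/funext => i; rewrite ffunE.
    rewrite -subset0 => x [Xx xt]; apply: h; exists x => // i.
    by case/andP: (xt i).
have -> : e%:E = (e / 4 + (e / 4 + (e / 4 + e / 4)))%:E by congr EFin; field.
apply: le_trans (mu_extU _ _ _) _.
apply: (@le_trans _ _ ((expR (- A) * J)%:E + ((2 * (expR (- A) * J))%:E +
    ((e / 4)%:E + ((e / 4)%:E + (e / 4)%:E))))%E).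
  apply: leeD => //; apply: le_trans (mu_extU _ _ _) _.
  apply: leeD => //; apply: le_trans (mu_extU _ _ _) _.
  apply: leeD => //; apply: le_trans (mu_extU _ _ _) _.
  exact: leeD.
rewrite -!EFinD lee_fin; lra.
Qed.
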